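(* Let $G$ be a finite nonabelian $2$-generator $2$-group of nilpotency class two, given by exactly one of the following presentations: (i) $G=\langle a,b\mid a^{2^{\alpha}}=b^{2^{\beta}}=[a,b]^{2^{\gamma}}=[a,b,a]=[a,b,b]=e\rangle$ with $\alpha\geq\beta\geq\gamma$ positive integers; (ii) $G=\langle a,b\mid a^{2^{\alpha}}=b^{2^{\beta}}=[a,b,a]=[a,b,b]=e,\ a^{2^{\alpha+\sigma-\gamma}}=[a,b]^{2^{\sigma}}\rangle$ with integers $\beta\geq\gamma>\sigma\geq 0$, $\alpha+\sigma\geq 2\gamma$, $\alpha+\beta+\sigma>3$; (iii) $G=\langle a,b\mid a^{2^{\gamma+1}}=b^{2^{\gamma+1}}=[a,b]^{2^{\gamma}}=[a,b,a]=[a,b,b]=e,\ a^{2^{\gamma}}=b^{2^{\gamma}}=[a,b]^{2^{\gamma-1}}\rangle$ with $\gamma$ a positive integer. Then $G$ is capable if and only if one of the following holds: (a) $G$ is of type (i) and $\alpha=\beta$; (b) $G$ is of type (i) and $\alpha=\beta+1=\gamma+1$; (c) $G$ is of type (ii), $\alpha=\beta$, and $\gamma<\beta-1$; (d) $G$ is of type (ii) and $\alpha=\beta+1=\gamma+1=\sigma+2$. In particular, if $G$ is of type (iii), then $G$ is not capable.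
   Context: A group $G$ is called capable if there exists a group $K$ such that $K/Z(K)\cong G$. Commutators are $[x,y]=x^{-1}y^{-1}xy$, left-normed: $[x,y,z]=[[x,y],z]$. It is known (Kappe–Visscher–Sarmin) that every finite nonabelian $2$-generator $2$-group of class two is isomorphic to exactly one group among types (i), (ii), (iii) with the stated parameter restrictions. *)

(* Defs.v *)
From mathcomp Require Import all_boot all_fingroup.
Set Implicit Arguments.
Unset Strict Implicit.
Unset Printing Implicit Defensive.
Local Open Scope group_scope.

Record is_group (K : Type) (mul : K -> K -> K) (one : K) (inv : K -> K) : Prop := {
  grp_mulA : forall x y z, mul x (mul y z) = mul (mul x y) z;
  grp_mul1 : forall x, mul one x = x;
  grp_mulV : forall x, mul (inv x) x = one }.

(* G is capable: there is a group K with K/Z(K) isomorphic to G, i.e. a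
   surjective homomorphism f : K -> G whose kernel is exactly Z(K)
   (first isomorphism theorem). *)
Definition capable (gT : finGroupType) (G : {group gT}) : Prop :=
  exists (K : Type) (mul : K -> K -> K) (one : K) (inv : K -> K),
    is_group mul one inv /\
    exists f : K -> gT,
      [/\ forall x y, f (mul x y) = f x * f y,
          forall x, f x \in G,
          forall g, g \in G -> exists x, f x = g
        & forall x, f x = 1 <-> (forall y, mul x y = mul y x)].

Definition type_i (gT : finGroupType) (G : {group gT}) (al be ga : nat) : Prop :=
  [/\ 0 < ga, ga <= be, be <= al &
   G \isog Grp (a : b : (a ^+ (2 ^ al)%N, b ^+ (2 ^ be)%N, [~ a, b] ^+ (2 ^ ga)%N,
                         [~ a, b, a], [~ a, b, b]))].

Definition type_ii (gT : finGroupType) (G : {group gT}) (al be ga si : nat) : Prop :=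
  [/\ ga <= be, si < ga, 2 * ga <= al + si, 3 < al + be + si &
   G \isog Grp (a : b : (a ^+ (2 ^ al)%N, b ^+ (2 ^ be)%N, [~ a, b, a], [~ a, b, b],
                         a ^+ (2 ^ (al + si - ga))%N = [~ a, b] ^+ (2 ^ si)%N))].

Definition type_iii (gT : finGroupType) (G : {group gT}) (ga : nat) : Prop :=
  0 < ga /\
   G \isog Grp (a : b : (a ^+ (2 ^ ga.+1)%N, b ^+ (2 ^ ga.+1)%N, [~ a, b] ^+ (2 ^ ga)%N,
                         [~ a, b, a], [~ a, b, b],
                         a ^+ (2 ^ ga)%N = [~ a, b] ^+ (2 ^ ga.-1)%N,
                         b ^+ (2 ^ ga)%N = [~ a, b] ^+ (2 ^ ga.-1)%N)).

(* Main.v *)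
(** If [K / Z(K) = G] and [x, y] in [K] lift the generators [a, b], then [K] is
    generated by [x, y] modulo its center, so [c = [x, y]], [d = [c, x]] and
    [e = [c, y]] control everything: [d, e] are central, and
    [[x^n, y] = c^n d^C(n,2)], [[x, y^n] = c^n e^C(n,2)].  Each relation of [G]
    holds in [K] up to a central factor, hence becomes a relation between
    [c, d, e]; outside the listed parameters these force the lift of one of
    [a^(2^be)], [a^(2^(be+1))], [b^(2^(be-1))], [[a, b]^(2^(ga-1))] to be
    central, although it is nontrivial in [G].

    Conversely, for the listed parameters [K] is the free nilpotent group of
    class three on [x, y], reduced modulo a large power of two, divided by a
    normal subgroup of [<c, d, e>] given by linear congruences on the exponents.
    The center of that quotient is read off from the commutators with [x] and
    [y], and the congruences are chosen so that it consists exactly of the words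
    that vanish in [G]. *)
Require Import Defs.
From HB Require Import structures.
From mathcomp Require Import all_boot all_order all_algebra all_fingroup.
From mathcomp Require Import boolp commutator center.
From mathcomp Require Import ring zify.
Set Implicit Arguments.
Unset Strict Implicit.
Unset Printing Implicit Defensive.

(** * Two-generator presentations of class two as lists of relations *)

Section Presentations.
Local Open Scope group_scope.

Definition relations := seq (nat * nat * nat).

(* A triple [(i, j, k)] stands for the relation [a^i b^j = [a, b]^k]; the
   relations making [[a, b]] central are always included. *)
Definition satisfies (s : relations) (gT : finGroupType) (a b : gT) : bool :=
  [&& [~ a, b, a] == 1, [~ a, b, b] == 1 &
      all (fun r => a ^+ r.1.1 * b ^+ r.1.2 == [~ a, b] ^+ r.2) s].

(** This is the property asserted by [G \isog Grp (...)], restated for a list of relations so that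
    the three types share all later lemmas. *)
Definition presents (s : relations) (gT : finGroupType) (G : {group gT}) : Prop :=
  forall (rT : finGroupType) (H : {group rT}),
    H \homg G <-> exists x y : rT, <[x]> <*> <[y]> = H /\ satisfies s x y.

Lemma presents_gen s (gT : finGroupType) (G : {group gT}) :
  presents s G -> exists a b, <[a]> <*> <[b]> = G /\ satisfies s a b.
Proof. by move=> pG; apply/(pG _ G); apply: homg_refl. Qed.

Lemma satisfies_commute s (gT : finGroupType) (a b : gT) :
  satisfies s a b -> commute [~ a, b] a /\ commute [~ a, b] b.
Proof. by case/and3P=> /commgP ? /commgP ? _. Qed.

Lemma satisfies_rel s (gT : finGroupType) (a b : gT) i j k :
  satisfies s a b -> (i, j, k) \in s -> a ^+ i * b ^+ j = [~ a, b] ^+ k.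
Proof. by case/and3P=> _ _ /allP sab /sab /eqP. Qed.

Let pairX (gT rT : finGroupType) (a : gT) (x : rT) n :
  (a, x) ^+ n = (a ^+ n, x ^+ n).
Proof. by elim: n => // n IHn; rewrite !expgS IHn. Qed.

(* The subgroup of [G * H] generated by [(a, x)] and [(b, y)] satisfies the
   defining relations of [G], so it is no larger than [G] and hence projects
   isomorphically onto [G]: it is the graph of the morphism a |-> x, b |-> y. *)
Lemma presents_transfer s (gT rT : finGroupType) (G : {group gT}) a b (x y : rT) i j k :
    presents s G -> <[a]> <*> <[b]> = G -> satisfies s a b -> satisfies s x y ->
  a ^+ i * b ^+ j = [~ a, b] ^+ k -> x ^+ i * y ^+ j = [~ x, y] ^+ k.
Proof.
move=> pG defG sab sxy rel_ab.
pose u := (a, x); pose v := (b, y); pose D := (<[u]> <*> <[v]>)%G.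
have comm_uv (a1 b1 : gT) (x1 y1 : rT) :
  [~ (a1, x1), (b1, y1)] = ([~ a1, b1], [~ x1, y1]) by [].
have suv : satisfies s u v.
  rewrite /satisfies /u /v !comm_uv.
  case/and3P: sab => /eqP-> /eqP-> sab; case/and3P: sxy => /eqP-> /eqP-> sxy.
  rewrite !eqxx /=; apply/allP=> r sr; rewrite !pairX.
  by apply/eqP; congr (_, _); apply/eqP; [apply: (allP sab) | apply: (allP sxy)].
have /leq_homg leDG : D \homg G by apply/(pG _ D); exists u, v.
pose f := restrm (subsetT D) (fst : gT * rT -> gT).
have imf : f @* D = G.
  by rewrite morphim_restrm setIid morphimY ?subsetT // !morphim_cycle ?in_setT ?defG.
have injf : 'injm f.
  by rewrite -card_im_injm eqn_leq leq_morphim imf.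
have Du : u \in D by rewrite mem_gen // inE cycle_id.
have Dv : v \in D by rewrite mem_gen // inE cycle_id orbT.
have [] : (a ^+ i * b ^+ j, x ^+ i * y ^+ j) = ([~ a, b] ^+ k, [~ x, y] ^+ k).
  apply: (injmP injf).
  - by rewrite -[(_, _)]/((a ^+ i, x ^+ i) * (b ^+ j, y ^+ j)) -!pairX groupM ?groupX.
  - by rewrite -pairX -comm_uv groupX ?groupR.
  - exact: rel_ab.
by [].
Qed.

End Presentations.

(** * Commutator calculus in nilpotency class three *)

Section ClassThree.
Local Open Scope group_scope.
Variables (K : groupType) (x y c d e : K).
Hypotheses (xy : x * y = y * x * c) (cx : c * x = x * c * d) (cy : c * y = y * c * e).
Hypotheses (dx : commute d x) (dy : commute d y) (dc : commute d c).
Hypotheses (ex : commute e x) (ey : commute e y) (ec : commute e c).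

Lemma expcMx n : c ^+ n * x = x * c ^+ n * d ^+ n.
Proof.
elim: n => [|n IHn]; first by rewrite !mulg1 mul1g.
rewrite {1}expgSr -mulgA cx !mulgA IHn (expgSr d) mulgA; congr (_ * _).
by rewrite -mulgA (commute_sym (commuteX n (commute_sym dc))) expgSr !mulgA.
Qed.

Lemma expcMy n : c ^+ n * y = y * c ^+ n * e ^+ n.
Proof.
elim: n => [|n IHn]; first by rewrite !mulg1 mul1g.
rewrite {1}expgSr -mulgA cy !mulgA IHn (expgSr e) mulgA; congr (_ * _).
by rewrite -mulgA (commute_sym (commuteX n (commute_sym ec))) expgSr !mulgA.
Qed.

(** In the induction the new [x] has to pass [c ^+ n], which costs [d ^+ n]; the costs
    [0 + ... + (n - 1)] add up to the binomial coefficient. *)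
Lemma expxMy n : x ^+ n * y = y * x ^+ n * c ^+ n * d ^+ 'C(n, 2).
Proof.
elim: n => [|n IHn]; first by rewrite !mulg1 mul1g.
have dX m z : commute d z -> d ^+ m * z = z * d ^+ m.
  by move=> dz; apply/commute_sym/commuteX/commute_sym.
rewrite {1}expgSr -mulgA xy !mulgA IHn binS bin1 addnC expgnDr.
rewrite -[_ * d ^+ _ * x]mulgA dX // mulgA -[_ * c ^+ n * x]mulgA expcMx !mulgA.
rewrite -[_ * d ^+ _ * c]mulgA dX // mulgA -[_ * d ^+ _ * c]mulgA dX // mulgA.
by rewrite (expgSr x) (expgSr c) !mulgA.
Qed.

Lemma xMexpy n : x * y ^+ n = y ^+ n * x * c ^+ n * e ^+ 'C(n, 2).
Proof.
elim: n => [|n IHn]; first by rewrite !mulg1 mul1g.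
have eX m z : commute e z -> e ^+ m * z = z * e ^+ m.
  by move=> ez; apply/commute_sym/commuteX/commute_sym.
rewrite {1}expgSr mulgA IHn binS bin1 addnC expgnDr.
rewrite -[_ * e ^+ _ * y]mulgA eX // mulgA -[_ * c ^+ n * y]mulgA expcMy !mulgA.
by rewrite -[y ^+ n * x * y]mulgA xy (expgSr y) (expgS c) !mulgA.
Qed.

Lemma expx_commute n : c ^+ n * d ^+ 'C(n, 2) = 1 -> commute (x ^+ n) y.
Proof. by rewrite /commute expxMy -mulgA => ->; rewrite mulg1. Qed.

Lemma expy_commute n : c ^+ n * e ^+ 'C(n, 2) = 1 -> commute x (y ^+ n).
Proof. by rewrite /commute xMexpy -mulgA => ->; rewrite mulg1. Qed.

Lemma commute_expcx n : commute (c ^+ n) x -> d ^+ n = 1.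
Proof. by rewrite /commute expcMx => /(canRL (mulKg _)); rewrite mulVg. Qed.

Lemma commute_expcy n : commute (c ^+ n) y -> e ^+ n = 1.
Proof. by rewrite /commute expcMy => /(canRL (mulKg _)); rewrite mulVg. Qed.

Lemma expc_commutex n : d ^+ n = 1 -> commute (c ^+ n) x.
Proof. by rewrite /commute expcMx => ->; rewrite mulg1. Qed.

Lemma expc_commutey n : e ^+ n = 1 -> commute (c ^+ n) y.
Proof. by rewrite /commute expcMy => ->; rewrite mulg1. Qed.

End ClassThree.

(** * Relations forced in [K] by capability *)

Section CapableLift.
Local Open Scope group_scope.

Section AsGroupType.
Variables (K : Type) (mul : K -> K -> K) (one : K) (inv : K -> K).

(** The alias of [K] depends on the proof of the group axioms, so that a [groupType] structure can
    be attached to it. *)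
Definition group_carrier of is_group mul one inv : Type := K.

Variable grpK : is_group mul one inv.
Let T := group_carrier grpK.

Let mulA : associative (mul : T -> T -> T). Proof. exact: grp_mulA grpK. Qed.
Let mul1 : left_id (one : T) (mul : T -> T -> T). Proof. exact: grp_mul1 grpK. Qed.
Let mulV : left_inverse (one : T) (inv : T -> T) (mul : T -> T -> T).
Proof. exact: grp_mulV grpK. Qed.
Let Vmul : right_inverse (one : T) (inv : T -> T) (mul : T -> T -> T).
Proof.
by move=> x; rewrite -[LHS]mul1 -{1}(mulV (inv x)) -mulA (mulA (inv x)) mulV mul1.
Qed.
Let mul_1 : right_id (one : T) (mul : T -> T -> T).
Proof. by move=> x; rewrite -(mulV x) mulA Vmul mul1. Qed.

HB.instance Definition _ := gen_eqMixin T.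
HB.instance Definition _ := gen_choiceMixin T.
HB.instance Definition _ := isGroup.Build T mulA mul1 mul_1 mulV Vmul.
Definition group_carrier_groupType : groupType := T.
End AsGroupType.

(** The last clause holds because [x] and [y] generate [K] modulo its center, so an element
    commuting with both is central. *)
Lemma capable_lift (gT : finGroupType) (G : {group gT}) (a b : gT) :
    capable G -> <[a]> <*> <[b]> = G ->
  exists (K : groupType) (f : K -> gT) (x y : K),
    [/\ {morph f : u v / u * v}, f x = a, f y = b,
        forall z u, f z = 1 -> commute z u
      & forall z, commute z x -> commute z y -> f z = 1].
Proof.
move=> [K [mul [one [inv [grpK [f [fM fG f_onto f_ker]]]]]]] defG.
pose KT := group_carrier_groupType grpK; pose g : KT -> gT := f.
have gM : {morph g : u v / u * v} by exact: fM.
have [x fx] : exists x, g x = a by apply: f_onto; rewrite -defG mem_gen // inE cycle_id.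
have [y fy] : exists y, g y = b.
  by apply: f_onto; rewrite -defG mem_gen // inE cycle_id orbT.
have g_ker (z : KT) : g z = 1 <-> forall u, commute z u by exact: f_ker.
exists KT, g, x, y; split=> // [z u /g_ker|z zx zy]; first exact.
have g1 : g 1 = 1 by apply/(mulgI (g 1)); rewrite -gM !mulg1.
have gV u : g u^-1 = (g u)^-1 by apply/(mulgI (g u)); rewrite -gM !mulgV g1.
(* [H] is the image in [G] of the centralizer of [z]. It contains [a] and [b], hence is all of [G],
   so every [u] agrees with an element centralizing [z] up to a factor in the kernel, which is
   central. *)
pose H := [set w | `[< exists2 u, g u = w & commute z u >]].
have HP w : reflect (exists2 u, g u = w & commute z u) (w \in H).
  by rewrite inE; apply: asboolP.
have grpH : group_set H.
  apply/group_setP; split=> [|w1 w2 /HP[u1 <- zu1] /HP[u2 <- zu2]].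
    by apply/HP; exists 1 => //; apply: commute1.
  by apply/HP; exists (u1 * u2) => //; apply: commuteM.
have sGH : G \subset Group grpH.
  rewrite -defG join_subG !cycle_subG; apply/andP; split; apply/HP.
    by exists x.
  by exists y.
apply/g_ker=> u; have /HP[v gv zv] := subsetP sGH _ (fG u).
rewrite -(mulVKg v u); apply: commuteM => //.
by apply/commute_sym; apply/(g_ker _).1; rewrite gM gV gv mulVg.
Qed.

(* With [x], [y] lifts of [a], [b] to a group [K] with [K / Z(K) = G], the
   elements [c], [d], [e] are [[x, y]], [[x, y, x]] and [[x, y, y]]. *)
Lemma capable_class3 (gT : finGroupType) (G : {group gT}) (a b : gT) :
    capable G -> <[a]> <*> <[b]> = G ->
    commute [~ a, b] a -> commute [~ a, b] b ->
  exists (K : groupType) (c d e : K),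
    [/\ commute d c /\ commute e c,
        forall m n, a ^+ m = [~ a, b] ^+ n ->
          d ^+ n = 1 /\ c ^+ m * d ^+ 'C(m, 2) = e ^+ n,
        forall m n, b ^+ m = [~ a, b] ^+ n ->
          e ^+ n = 1 /\ c ^+ m * e ^+ 'C(m, 2) * d ^+ n = 1
      & [/\ forall n, [~ a, b] ^+ n = 1 -> d ^+ n = 1 /\ e ^+ n = 1,
            forall n, c ^+ n * d ^+ 'C(n, 2) = 1 -> a ^+ n = 1,
            forall n, c ^+ n * e ^+ 'C(n, 2) = 1 -> b ^+ n = 1
          & forall n, d ^+ n = 1 -> e ^+ n = 1 -> [~ a, b] ^+ n = 1]].
Proof.
move=> capG defG ca cb.
have [K [f [x [y [fM fx fy f_ker f_eq1]]]]] := capable_lift capG defG.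
have f1 : f 1 = 1 by apply/(mulgI (f 1)); rewrite -fM !mulg1.
have fV u : f u^-1 = (f u)^-1 by apply/(mulgI (f u)); rewrite -fM !mulgV f1.
have fX u n : f (u ^+ n) = f u ^+ n.
  by elim: n => // n IHn; rewrite !expgS fM IHn.
have fR u v : f [~ u, v] = [~ f u, f v] by rewrite !fM !fV.
pose c := [~ x, y]; pose d := [~ c, x]; pose e := [~ c, y].
have fc : f c = [~ a, b] by rewrite fR fx fy.
have d_central u : commute d u by apply: f_ker; rewrite fR fc fx; apply/eqP/commgP.
have e_central u : commute e u by apply: f_ker; rewrite fR fc fy; apply/eqP/commgP.
have xy : x * y = y * x * c by exact: commgC.
have cx : c * x = x * c * d by exact: commgC.
have cy : c * y = y * c * e by exact: commgC.
have dX n u : d ^+ n * u = u * d ^+ n by apply/commute_sym/commuteX/commute_sym.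
have eX n u : e ^+ n * u = u * e ^+ n by apply/commute_sym/commuteX/commute_sym.
have x_cX := expcMx cx (d_central c).
have y_cX := expcMy cy (e_central c).
exists K, c, d, e; split; [by [] | move=> m n | move=> m n | split=> n].
- rewrite -fc -fx -!fX => fxc.
  (* The relation of [G] holds in [K] up to a central [z]. Commuting [c ^+ n * z] with [x] then
     gives [d ^+ n = 1], and with [y] it gives [e ^+ n] as the value of [[x^m, y]]. *)
  have [z z_central defx] : exists2 z, forall u, commute z u & x ^+ m = c ^+ n * z.
    exists ((c ^+ n)^-1 * x ^+ m); last by rewrite mulVKg.
    by move=> u; apply: f_ker; rewrite fM fV fxc mulVg.
  have d1 : d ^+ n = 1.
    have : x ^+ m * x = x * x ^+ m by rewrite -expgSr expgS.
    rewrite defx -mulgA z_central !mulgA x_cX -(mulgA _ (d ^+ n)) dX mulgA.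
    by move=> /(canRL (mulKg _)); rewrite mulVg.
  split=> //; apply: (mulgI (y * x ^+ m)); rewrite !mulgA -expxMy //.
  by rewrite defx -mulgA z_central !mulgA y_cX -!mulgA eX !mulgA.
- rewrite -fc -fy -!fX => fyc.
  have [z z_central defy] : exists2 z, forall u, commute z u & y ^+ m = c ^+ n * z.
    exists ((c ^+ n)^-1 * y ^+ m); last by rewrite mulVKg.
    by move=> u; apply: f_ker; rewrite fM fV fyc mulVg.
  have e1 : e ^+ n = 1.
    have : y ^+ m * y = y * y ^+ m by rewrite -expgSr expgS.
    rewrite defy -mulgA z_central !mulgA y_cX -(mulgA _ (e ^+ n)) eX mulgA.
    by move=> /(canRL (mulKg _)); rewrite mulVg.
  (* Here [[x, y^m] = [x, c^n]] is the inverse of [d ^+ n], which is why [d ^+ n] stands on the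
     left, unlike [e ^+ n] in the previous case. *)
  split=> //; apply: (mulgI (y ^+ m * x)); rewrite !mulgA -xMexpy // mulg1.
  by rewrite defy -[RHS]mulgA z_central !mulgA x_cX -!mulgA z_central.
- move=> c1; have cn_central u : commute (c ^+ n) u by apply: f_ker; rewrite fX fc.
  by split; [exact: (commute_expcx cx) | exact: (commute_expcy cy)].
- move=> cd1; rewrite -fx -fX; apply: f_eq1; last exact: expx_commute cd1.
  exact/commute_sym/commuteX.
- move=> ce1; rewrite -fy -fX; apply: f_eq1; last exact/commute_sym/commuteX.
  by apply/commute_sym; apply: expy_commute ce1.
- move=> d1 e1; rewrite -fc -fX; apply: f_eq1.
    exact: expc_commutex d1.
  exact: expc_commutey e1.
Qed.

End CapableLift.

(** * The free nilpotent group of class three in polynomial coordinates *)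

Section Malcev.
Import GRing.Theory.
Local Open Scope ring_scope.
Variable n : nat.

(* [(i, j, k, l, m)] encodes [x^i y^j c^k d^(l/2) e^(m/2)] in the free nilpotent
   group of class three on [x], [y], reduced modulo [n], where [c = [x, y]],
   [d = [c, x]] and [e = [c, y]].  Doubling the last two exponents turns the
   binomial coefficients of the multiplication law into integer polynomials. *)
Definition malcev : Type := ('Z_n * 'Z_n * 'Z_n * 'Z_n * 'Z_n)%type.

(** Collection formula: the terms in [2%:R * k] arise when [c^k] passes [x^i'] and [y^j']. The
    others arise when [x^i'] passes [y^j], and when the resulting power of [c] passes [y^j']. *)
Definition malcev_mul (u v : malcev) : malcev :=
  let: (i, j, k, l, m) := u in let: (i', j', k', l', m') := v in
  (i + i', j + j', k + k' - i' * j,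
   l + l' + 2%:R * k * i' - i' * (i' - 1) * j,
   m + m' + 2%:R * k * j' - i' * (j * (j - 1) + 2%:R * j * j')).

Definition malcev_one : malcev := (0, 0, 0, 0, 0).

Definition malcev_inv (u : malcev) : malcev :=
  let: (i, j, k, l, m) := u in
  (- i, - j, - k - i * j,
   - l + 2%:R * (k + i * j) * i - i * (i - 1) * j,
   - m + 2%:R * (k + i * j) * j + i * (j - j ^+ 2)).

Lemma malcev_mulA : associative malcev_mul.
Proof.
move=> [[[[i j] k] l] m] [[[[i' j'] k'] l'] m'] [[[[i2 j2] k2] l2] m2] /=.
by do !congr (_, _); ring.
Qed.

Lemma malcev_mul1 : left_id malcev_one malcev_mul.
Proof. by move=> [[[[i j] k] l] m] /=; do !congr (_, _); ring. Qed.

Lemma malcev_mulV : left_inverse malcev_one malcev_inv malcev_mul.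
Proof.
by move=> [[[[i j] k] l] m] /=; rewrite /malcev_one; do !congr (_, _); ring.
Qed.

HB.instance Definition _ := Finite.copy malcev ('Z_n * 'Z_n * 'Z_n * 'Z_n * 'Z_n)%type.
HB.instance Definition _ :=
  Finite_isGroup.Build malcev malcev_mulA malcev_mul1 malcev_mulV.

Lemma malcev_mulE (u v : malcev) : (u * v)%g = malcev_mul u v. Proof. by []. Qed.
Lemma malcev_invE (u : malcev) : (u^-1)%g = malcev_inv u. Proof. by []. Qed.

Definition malcev_x : malcev := (1, 0, 0, 0, 0).
Definition malcev_y : malcev := (0, 1, 0, 0, 0).

Lemma malcev_commxy : [~ malcev_x, malcev_y]%g = (0, 0, 1, 0, 0) :> malcev.
Proof.
apply: (@mulgI _ (malcev_y * malcev_x)%g); rewrite -commgC !malcev_mulE /=.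
by do !congr (_, _); ring.
Qed.

Lemma malcev_expx r : (malcev_x ^+ r)%g = (r%:R, 0, 0, 0, 0) :> malcev.
Proof.
elim: r => // r IHr; rewrite expgSr IHr malcev_mulE /= -[r.+1%:R]natr1.
by do !congr (_, _); ring.
Qed.

Lemma malcev_expy r : (malcev_y ^+ r)%g = (0, r%:R, 0, 0, 0) :> malcev.
Proof.
elim: r => // r IHr; rewrite expgSr IHr malcev_mulE /= -[r.+1%:R]natr1.
by do !congr (_, _); ring.
Qed.

Lemma malcev_expc r : ([~ malcev_x, malcev_y] ^+ r)%g = (0, 0, r%:R, 0, 0) :> malcev.
Proof.
rewrite malcev_commxy; elim: r => // r IHr.
rewrite expgSr IHr malcev_mulE /= -[r.+1%:R]natr1.
by do !congr (_, _); ring.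
Qed.

Lemma malcev_comm_x (i j k l m : 'Z_n) :
  [~ (i, j, k, l, m) : malcev, malcev_x]%g = (0, 0, - j, 2%:R * k, - (j * (j - 1))).
Proof.
apply: (@mulgI _ (malcev_x * (i, j, k, l, m) : malcev)%g).
by rewrite -commgC !malcev_mulE /=; do !congr (_, _); ring.
Qed.

Lemma malcev_comm_y (i j k l m : 'Z_n) :
  [~ (i, j, k, l, m) : malcev, malcev_y]%g =
    (0, 0, i, i * (i - 1), 2%:R * k + 2%:R * i * j).
Proof.
apply: (@mulgI _ (malcev_y * (i, j, k, l, m) : malcev)%g).
by rewrite -commgC !malcev_mulE /=; do !congr (_, _); ring.
Qed.

Lemma malcev_normal_form (i j k l m : 'Z_n) :
  (i, j, k, l, m) =
  (malcev_x ^+ i * malcev_y ^+ j * [~ malcev_x, malcev_y] ^+ k * (0, 0, 0, l, m))%g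
  :> malcev.
Proof.
rewrite malcev_expx malcev_expy malcev_expc !natr_Zp !malcev_mulE /=.
by do !congr (_, _); ring.
Qed.

Lemma malcev_tail_central (l m : 'Z_n) (u : malcev) :
  commute u ((0, 0, 0, l, m) : malcev).
Proof.
case: u => [[[[i j] k] l'] m']; rewrite /commute !malcev_mulE /=.
by do !congr (_, _); ring.
Qed.

End Malcev.

(** * The center of a quotient, pulled back to the group *)

Section RelativeCenter.
Local Open Scope group_scope.

Lemma coset_eq1 (hT : finGroupType) (Q : {group hT}) u :
  u \in 'N(Q) -> (coset Q u == 1) = (u \in Q).
Proof. by move=> Nu; apply/eqP/idP=> [/coset_idr->|/coset_id]. Qed.

Variables (hT : finGroupType) (Q : {group hT}).

Definition rel_center : {group hT} := (coset Q @*^-1 'Z([set: hT] / Q))%G.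

Hypothesis nQ : Q <| [set: hT].
Let inN u : u \in 'N(Q). Proof. exact: (subsetP (normal_norm nQ)) (in_setT u). Qed.

Lemma rel_centerP u : reflect (forall v, [~ u, v] \in Q) (u \in rel_center).
Proof.
have comm_uv v : ([~ coset Q u, coset Q v] == 1) = ([~ u, v] \in Q).
  by rewrite -morphR ?inN // coset_eq1.
have -> : (u \in rel_center) = (coset Q u \in 'Z([set: hT] / Q)).
  by rewrite /= morphpreE in_setI inN inE.
apply: (iffP (centerP _ _)) => [[_ Zu] v|Zu].
  by rewrite -comm_uv; apply/commgP/Zu/mem_quotient/in_setT.
split=> [|_ /morphimP[v _ _ ->]]; first exact/mem_quotient/in_setT.
by apply/commgP; rewrite comm_uv.
Qed.

Lemma rel_center_normal : rel_center <| [set: hT].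
Proof.
have -> : [set: hT] = coset Q @*^-1 ([set: hT] / Q).
  by rewrite quotientGK.
by rewrite cosetpre_normal center_normal.
Qed.

(** For fixed [u], the [v] with [[~ u, v] \in Q] form a group, by [[u, v w] = [u, w] [u, v]^w] and
    normality of [Q]; this group contains [rel_center]. *)
Lemma rel_center_gen x y u :
    [set: hT] = <[x]> <*> <[y]> <*> rel_center ->
  (u \in rel_center) = ([~ u, x] \in Q) && ([~ u, y] \in Q).
Proof.
move=> defT; apply/rel_centerP/andP=> [Zu|[ux uy]]; first by rewrite !Zu.
have Ngrp : group_set [set v | [~ u, v] \in Q].
  apply/group_setP; split=> [|v w]; rewrite !inE ?commg1 ?group1 // => uv uw.
  by rewrite commgMJ groupM // memJ_norm // inN.
move=> v; have: v \in Group Ngrp; last by rewrite inE.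
apply: subsetP (in_setT v); rewrite defT !join_subG !cycle_subG !inE ux uy /=.
apply/subsetP=> z /rel_centerP/(_ u); rewrite inE => zu.
by rewrite -invgR groupV.
Qed.

(** The witness is [K = hT / Q]. Normality puts [Q] inside [rel_center], so [F] is constant on
    cosets and the induced map has the center of [hT / Q] as kernel. *)
Lemma capable_of_quotient (gT : finGroupType) (G : {group gT}) (F : hT -> gT) :
    {morph F : u v / u * v} -> (forall u, F u \in G) ->
    (forall g, g \in G -> exists u, F u = g) ->
    (forall u, F u = 1 <-> u \in rel_center) ->
  capable G.
Proof.
move=> FM FG F_onto F_ker.
have FQ u : u \in Q -> F u = 1.
  move=> Qu; apply/F_ker/rel_centerP=> v; rewrite commgEl groupM ?groupV //.
  by rewrite memJ_norm ?inN.
have F_coset u : F (repr (coset Q u)) = F u.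
  have: repr (coset Q u) \in coset Q u by apply: mem_repr_coset.
  rewrite val_coset ?inN // => /rcosetP[q Qq ->].
  by rewrite FM FQ // mul1g.
exists (coset_of Q), (fun X Y => X * Y), 1, (fun X => X^-1); split.
  by split; [exact: mulgA | exact: mul1g | exact: mulVg].
have cosetE (X : coset_of Q) : X = coset Q (repr X) by rewrite coset_reprK.
exists (fun X => F (repr X)); split=> [X Y|X|g Gg|X].
- by rewrite {1}(cosetE X) {1}(cosetE Y) -morphM ?inN // F_coset FM.
- exact: FG.
- by have [u Fu] := F_onto g Gg; exists (coset Q u); rewrite F_coset.
split=> [/F_ker/rel_centerP ZX Y|ZX].
  have defXY : [~ X, Y] = coset Q [~ repr X, repr Y].
    by rewrite morphR ?inN //= !coset_reprK.
  by apply/commgP; rewrite defXY coset_id.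
apply/F_ker/rel_centerP=> v; apply: coset_idr; rewrite ?inN //.
by rewrite morphR ?inN //= coset_reprK; apply/eqP/commgP/ZX.
Qed.

End RelativeCenter.

(** * Transfer of the relations of [G] to a quotient *)

Section PresentationModulo.
Local Open Scope group_scope.

Lemma presents_transfer_mod s (gT hT : finGroupType) (G : {group gT}) a b
    (C : {group hT}) (x y : hT) :
    presents s G -> <[a]> <*> <[b]> = G -> satisfies s a b -> C <| [set: hT] ->
    [~ x, y, x] \in C -> [~ x, y, y] \in C ->
    (forall r, r \in s -> x ^+ r.1.1 * y ^+ r.1.2 * [~ x, y] ^- r.2 \in C) ->
  forall i j k, a ^+ i * b ^+ j = [~ a, b] ^+ k ->
    x ^+ i * y ^+ j * [~ x, y] ^- k \in C.
Proof.
move=> pG defG sab nC Cx Cy Cs i j k rel_ab.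
have inN u : u \in 'N(C) by exact: (subsetP (normal_norm nC)) (in_setT u).
pose x' := coset C x; pose y' := coset C y.
have relE i' j' k' : (x' ^+ i' * y' ^+ j' == [~ x', y'] ^+ k')
    = (x ^+ i' * y ^+ j' * [~ x, y] ^- k' \in C).
  rewrite -morphR ?inN // -!morphX ?inN // -morphM ?inN // eq_mulgV1.
  rewrite -morphV ?inN // -morphM ?inN //.
  by rewrite coset_eq1.
have sxy : satisfies s x' y'.
  have comm3 z : [~ x', y', coset C z] = coset C [~ x, y, z] by rewrite !morphR ?inN.
  rewrite /satisfies !comm3 !coset_id // eqxx /=.
  by apply/allP=> r sr; rewrite relE Cs.
by rewrite -relE; apply/eqP; apply: presents_transfer rel_ab.
Qed.

End PresentationModulo.

(** * Divisibility of residues modulo [n] *)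

Section ZnDivisibility.
Import GRing.Theory.
Local Open Scope ring_scope.
Variable n : nat.

(** The test is made on the canonical representative. When [d] divides [n] it does not depend on the
    representative, so congruences in ['Z_n] become divisibilities of integers. *)
Definition zdvd d (z : 'Z_n) : bool := (d %| z)%N.

Lemma zdvd_trans d d' z : (d %| d')%N -> zdvd d' z -> zdvd d z.
Proof. exact: dvdn_trans. Qed.

Variable d : nat.
Hypotheses (n_gt1 : (1 < n)%N) (dn : (d %| n)%N).

Lemma zdvd_nat r : zdvd d r%:R = (d %| r)%N.
Proof. by rewrite /zdvd val_Zp_nat // /dvdn modn_dvdm. Qed.

Lemma zdvd_int (r : int) : zdvd d r%:~R = (d %| r)%Z.
Proof.
have n0 : n%:R = 0 :> 'Z_n by apply/val_inj; rewrite /= val_Zp_nat // modnn.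
rewrite {1}(divz_eq r n) intrD intrM [n%:~R]n0 mulr0 add0r.
have /gez0_abs {1}<- : (0 <= r %% n)%Z by rewrite modz_ge0 //; lia.
rewrite zdvd_nat [in RHS](divz_eq r n) rpredDl // dvdz_mull // dvdzE.
Qed.

Lemma Zn_int (z : 'Z_n) : z = (z : nat)%:~R.
Proof. by rewrite -[LHS]natr_Zp. Qed.

Lemma zdvdD z z' : zdvd d z -> zdvd d z' -> zdvd d (z + z').
Proof.
rewrite (Zn_int z) (Zn_int z') -intrD !zdvd_int; exact: rpredD.
Qed.

Lemma zdvdMl z z' : zdvd d z -> zdvd d (z' * z).
Proof.
rewrite (Zn_int z) (Zn_int z') -intrM !zdvd_int; exact: dvdz_mull.
Qed.

End ZnDivisibility.

Lemma zdvd_scale n d d' r (z : 'Z_n) :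
    (1 < n)%N -> (d %| n)%N -> (d' %| n)%N -> (d %| r * d')%N ->
  zdvd d' z -> zdvd d (r%:R * z)%R.
Proof.
move=> n_gt1 dn d'n drd'; rewrite (Zn_int z) -[r%:R%R]/(r%:~R)%R -intrM.
rewrite !zdvd_int // => /dvdzP[q ->].
by rewrite GRing.mulrCA dvdz_mull.
Qed.

(** * Quotients by words in [c], [d], [e], and their centers *)

Section MalcevQuotient.
Import GRing.Theory.
Local Open Scope group_scope.
Local Open Scope ring_scope.
Variables (n t p s N eta w : nat).

(* The words [c^k d^(l/2) e^(m/2)] killed in the quotient. *)
Definition tail_cond (k l m : 'Z_n) : bool :=
  [&& zdvd t k, zdvd p l, zdvd s m & zdvd N (k + eta%:R * l + w%:R * m)].

Definition tail_set : {set malcev n} :=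
  [set u : malcev n | let: (i, j, k, l, m) := u in
     [&& i == 0, j == 0 & tail_cond k l m]].

Hypothesis n_gt1 : (1 < n)%N.
Hypotheses (tn : (t %| n)%N) (pn : (p %| n)%N) (sn : (s %| n)%N) (Nn : (N %| n)%N).
Hypotheses (pt : (p %| 2 * t)%N) (st : (s %| 2 * t)%N).
Hypotheses (Neta : (N %| 2 * t * eta)%N) (Nw : (N %| 2 * t * w)%N).

Lemma tail_group_set : group_set tail_set.
Proof.
apply/group_setP; split.
  by rewrite inE /= /tail_cond !mulr0 !addr0 /zdvd !dvdn0.
move=> [[[[i j] k] l] m] [[[[i' j'] k'] l'] m']; rewrite ![_ \in tail_set]inE.
case/and3P=> /eqP-> /eqP-> /and4P[k1 l1 m1 N1].
case/and3P=> /eqP-> /eqP-> /and4P[k2 l2 m2 N2].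
suff -> : (((0, 0, k, l, m) : malcev n) * ((0, 0, k', l', m') : malcev n))%g
    = (0, 0, k + k', l + l', m + m').
  rewrite !eqxx /tail_cond (zdvdD _ _ k1) // (zdvdD _ _ l1) // (zdvdD _ _ m1) //=.
  have -> : k + k' + eta%:R * (l + l') + w%:R * (m + m')
    = k + eta%:R * l + w%:R * m + (k' + eta%:R * l' + w%:R * m') by ring.
  exact: zdvdD.
by rewrite malcev_mulE /=; do !congr (_, _); ring.
Qed.

Definition tail_group : {group malcev n} := Group tail_group_set.

Lemma tail_groupE (i j k l m : 'Z_n) :
  (((i, j, k, l, m) : malcev n) \in tail_group)
    = [&& i == 0, j == 0 & tail_cond k l m].
Proof. by rewrite inE. Qed.

(** Conjugation keeps [k] and adds multiples of [2 k] to [l] and [m]. Since [t] divides [k], the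
    hypotheses on [2 * t] absorb these changes. *)
Lemma tail_group_normal : tail_group <| [set: malcev n].
Proof.
apply/andP; split; first exact: subsetT.
apply/subsetP=> g _; rewrite inE; apply/subsetP=> _ /imsetP[u Qu ->].
case: u Qu => [[[[i j] k] l] m]; case: g => [[[[i' j'] k'] l'] m'].
rewrite tail_groupE => /and3P[/eqP-> /eqP-> /and4P[k1 l1 m1 N1]].
suff -> : (((0, 0, k, l, m) : malcev n) ^ ((i', j', k', l', m') : malcev n))%g
    = (0, 0, k, l + 2%:R * k * i', m + 2%:R * k * j').
  rewrite tail_groupE !eqxx /tail_cond k1 /=.
  have scale d r z : (d %| n)%N -> (d %| r * t)%N -> zdvd d (r%:R * k * z).
    by move=> dn drt; rewrite mulrC zdvdMl // (zdvd_scale _ _ tn).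
  rewrite (zdvdD _ _ l1) ?scale // (zdvdD _ _ m1) ?scale //=.
  have -> : k + eta%:R * (l + 2%:R * k * i') + w%:R * (m + 2%:R * k * j')
     = k + eta%:R * l + w%:R * m
       + ((2 * eta)%:R * k * i' + (2 * w)%:R * k * j') by rewrite !natrM; ring.
  by rewrite zdvdD // zdvdD // scale // mulnAC.
apply: (@mulgI _ ((i', j', k', l', m') : malcev n)).
by rewrite -conjgC !malcev_mulE /=; do !congr (_, _); ring.
Qed.

Lemma malcev_generated (C : {group malcev n}) :
  (forall l m, ((0, 0, 0, l, m) : malcev n) \in C) ->
  [set: malcev n] = <[malcev_x n]> <*> <[malcev_y n]> <*> C.
Proof.
move=> sC; apply/esym/eqP; rewrite -subTset; apply/subsetP=> u _.
case: u => [[[[i j] k] l] m]; rewrite malcev_normal_form.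
have xG : malcev_x n \in <[malcev_x n]> <*> <[malcev_y n]> <*> C.
  by apply: (subsetP (joing_subl _ _)); rewrite mem_gen // inE cycle_id.
have yG : malcev_y n \in <[malcev_x n]> <*> <[malcev_y n]> <*> C.
  by apply: (subsetP (joing_subl _ _)); rewrite mem_gen // inE cycle_id orbT.
rewrite !groupM ?groupX ?groupR //.
by apply: (subsetP (joing_subr _ _)).
Qed.

(* The first four conditions express that the commutator with [malcev_x] lies in
   [tail_group], the last four that the commutator with [malcev_y] does. *)
Definition central_cond (i j k : int) : bool :=
  [&& (t %| j)%Z, (p %| 2 * k)%Z, (s %| j * (j - 1))%Z,
      (N %| - j + eta%:Z * (2 * k) - w%:Z * (j * (j - 1)))%Z
    & [&& (t %| i)%Z, (p %| i * (i - 1))%Z, (s %| 2 * k + 2 * i * j)%Z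
        & (N %| i + eta%:Z * (i * (i - 1)) + w%:Z * (2 * k + 2 * i * j))%Z]].

(** Tails [(0, 0, 0, l, m)] are central, so the commutators with [malcev_x] and [malcev_y] decide;
    their coordinates are integer polynomials in [i], [j], [k]. *)
Lemma mem_rel_center (i j k : int) (l m : 'Z_n) :
  (((i%:~R, j%:~R, k%:~R, l, m) : malcev n) \in rel_center tail_group)
    = central_cond i j k.
Proof.
have defT : [set: malcev n] =
    <[malcev_x n]> <*> <[malcev_y n]> <*> rel_center tail_group.
  apply: malcev_generated => l' m'; apply/(rel_centerP tail_group_normal)=> v.
  have /commute_sym/commgP/eqP-> := malcev_tail_central l' m' v.
  exact: group1.
rewrite (rel_center_gen tail_group_normal _ defT).
rewrite malcev_comm_x malcev_comm_y !tail_groupE !eqxx /= /tail_cond.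
have -> : - j%:~R = (- j)%:~R :> 'Z_n by ring.
have -> : 2%:R * k%:~R = (2 * k)%:~R :> 'Z_n by ring.
have -> : - (j%:~R * (j%:~R - 1)) = (- (j * (j - 1)))%:~R :> 'Z_n by ring.
have -> : i%:~R * (i%:~R - 1) = (i * (i - 1))%:~R :> 'Z_n by ring.
have -> : (2 * k)%:~R + 2%:R * i%:~R * j%:~R = (2 * k + 2 * i * j)%:~R :> 'Z_n by ring.
rewrite -[eta%:R]/(eta%:~R) -[w%:R]/(w%:~R) -!intrM -!intrD !zdvd_int //.
by rewrite !rpredN mulrN -!andbA.
Qed.

End MalcevQuotient.

(** * Lower bounds for orders from quotients of class two *)

Section OrderBounds.
Import GRing.Theory.
Local Open Scope group_scope.
Local Open Scope ring_scope.
Variables (n T U S N v w : nat).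

(* Dividing by this subgroup kills [d], [e] and suitable words in [x], [y], [c];
   the quotients bound from below the orders of elements of [G]. *)
Definition class2_set : {set malcev n} :=
  [set u : malcev n | let: (i, j, k, l, m) := u in
     [&& zdvd T i, zdvd U j, zdvd S k & zdvd N (i + v%:R * j + w%:R * k)]].

Hypothesis n_gt1 : (1 < n)%N.
Hypotheses (Tn : (T %| n)%N) (Un : (U %| n)%N) (Sn : (S %| n)%N) (Nn : (N %| n)%N).
Hypotheses (ST : (S %| T)%N) (SU : (S %| U)%N).
Hypotheses (NT : (N %| w * T)%N) (NU : (N %| w * U)%N).

Lemma class2_group_set : group_set class2_set.
Proof.
apply/group_setP; split.
  by rewrite inE /= !mulr0 !addr0 /zdvd !dvdn0.
move=> [[[[i j] k] l] m] [[[[i' j'] k'] l'] m']; rewrite ![_ \in class2_set]inE.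
case/and4P=> i1 j1 k1 N1; case/and4P=> i2 j2 k2 N2.
rewrite malcev_mulE /=; apply/and4P; split; try exact: zdvdD.
  by rewrite -mulNr zdvdD ?(zdvdD _ _ k1) // zdvdMl // (zdvd_trans SU).
have -> : i + i' + v%:R * (j + j') + w%:R * (k + k' - i' * j)
  = i + v%:R * j + w%:R * k + (i' + v%:R * j' + w%:R * k')
    + - i' * (w%:R * j) by ring.
by rewrite zdvdD ?(zdvdD _ _ N1) // zdvdMl // (zdvd_scale _ _ Un).
Qed.

Definition class2_group : {group malcev n} := Group class2_group_set.

Lemma class2_groupE (i j k l m : 'Z_n) :
  (((i, j, k, l, m) : malcev n) \in class2_group)
    = [&& zdvd T i, zdvd U j, zdvd S k & zdvd N (i + v%:R * j + w%:R * k)].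
Proof. by rewrite inE. Qed.

(** Apart from [l] and [m], conjugation only adds [i * j' - i' * j] to [k]; the hypotheses on [S]
    and [N] say that this is harmless. *)
Lemma class2_group_normal : class2_group <| [set: malcev n].
Proof.
apply/andP; split; first exact: subsetT.
apply/subsetP=> g _; rewrite inE; apply/subsetP=> _ /imsetP[u Qu ->].
case: u Qu => [[[[i j] k] l] m]; case: g => [[[[i' j'] k'] l'] m'].
rewrite class2_groupE => /and4P[i1 j1 k1 N1].
have [l2 [m2 ->]] : exists l2 m2 : 'Z_n,
    (((i, j, k, l, m) : malcev n) ^ ((i', j', k', l', m') : malcev n))%g
    = (i, j, k + i * j' - i' * j, l2, m2).
  exists (l + 2%:R * k * i' - i' * (i' - 1) * j - 2%:R * k' * i + i * (i - 1) * j'),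
    (m + 2%:R * k * j' - i' * (j * (j - 1) + 2%:R * j * j') - 2%:R * k' * j
       + i * (j' * (j' - 1) + 2%:R * j' * j)).
  apply: (@mulgI _ ((i', j', k', l', m') : malcev n)).
  by rewrite -conjgC !malcev_mulE /=; do !congr (_, _); ring.
rewrite class2_groupE i1 j1 /=; apply/andP; split.
  have Sij : zdvd S (i * j') by rewrite mulrC zdvdMl // (zdvd_trans ST).
  have Sij' : zdvd S (- i' * j) by rewrite zdvdMl // (zdvd_trans SU).
  by rewrite -mulNr zdvdD // zdvdD.
have -> : i + v%:R * j + w%:R * (k + i * j' - i' * j)
  = i + v%:R * j + w%:R * k + (j' * (w%:R * i) + - i' * (w%:R * j)) by ring.
have Nwi : zdvd N (j' * (w%:R * i)) by rewrite zdvdMl // (zdvd_scale _ _ Tn).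
have Nwj : zdvd N (- i' * (w%:R * j)) by rewrite zdvdMl // (zdvd_scale _ _ Un).
by rewrite zdvdD // zdvdD.
Qed.

(** A relation [a^i b^j = [a, b]^k] is tested on the word [x^i y^j c^(-k)], whence the sign before
    [w]. *)
Definition class2_cond (i j k : int) : bool :=
  [&& (T %| i)%Z, (U %| j)%Z, (S %| k)%Z & (N %| i + v%:Z * j - w%:Z * k)%Z].

Lemma class2_bound s (gT : finGroupType) (G : {group gT}) a b :
    presents s G -> <[a]> <*> <[b]> = G -> satisfies s a b ->
    (forall r, r \in s -> class2_cond r.1.1 r.1.2 r.2) ->
  forall i j k, (a ^+ i * b ^+ j = [~ a, b] ^+ k)%g -> class2_cond i j k.
Proof.
move=> pG defG sab ok_s i j k rel_ab.
have condE (i1 j1 k1 : nat) : ((malcev_x n ^+ i1 * malcev_y n ^+ j1 *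
    [~ malcev_x n, malcev_y n] ^- k1)%g \in class2_group) = class2_cond i1 j1 k1.
  rewrite malcev_expx malcev_expy malcev_expc.
  have -> : (((i1%:R, 0, 0, 0, 0) : malcev n) * ((0, j1%:R, 0, 0, 0) : malcev n)
      * ((0, 0, k1%:R, 0, 0) : malcev n)^-1)%g
    = (i1%:~R, j1%:~R, (- k1%:Z)%:~R, 0, 0).
    by rewrite malcev_invE !malcev_mulE /=; do !congr (_, _); ring.
  rewrite class2_groupE -[v%:R]/(v%:~R) -[w%:R]/(w%:~R) -!intrM -!intrD !zdvd_int //.
  by rewrite rpredN mulrN.
rewrite -condE; apply: presents_transfer_mod rel_ab => //.
- exact: class2_group_normal.
- by rewrite malcev_commxy malcev_comm_x class2_groupE oppr0 !mulr0 !addr0 /zdvd !dvdn0.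
- by rewrite malcev_commxy malcev_comm_y class2_groupE !mulr0 !addr0 /zdvd !dvdn0.
by move=> r sr; rewrite condE ok_s.
Qed.

End OrderBounds.

(** * Powers with exponents in ['Z_n] *)

Section ZnExponents.
Import GRing.Theory.
Local Open Scope group_scope.
Variables (n : nat) (gT : finGroupType) (g : gT).
Hypotheses (n_gt1 : 1 < n) (gn : g ^+ n = 1).

Lemma expg_Zn_nat r : g ^+ (r%:R : 'Z_n)%R = g ^+ r.
Proof. by rewrite val_Zp_nat // expg_mod. Qed.

Lemma expg_ZnD (z z' : 'Z_n) : g ^+ (z + z')%R = g ^+ z * g ^+ z'.
Proof. by rewrite -{1}(natr_Zp z) -{1}(natr_Zp z') -natrD expg_Zn_nat expgnDr. Qed.

Lemma expg_ZnM (z z' : 'Z_n) : g ^+ (z * z')%R = g ^+ (z * z')%N.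
Proof. by rewrite -{1}(natr_Zp z) -{1}(natr_Zp z') -natrM expg_Zn_nat. Qed.

Lemma expg_ZnN (z : 'Z_n) : g ^+ (- z)%R = g ^- z.
Proof. by apply/(mulgI (g ^+ z)); rewrite -expg_ZnD subrr mulgV. Qed.

End ZnExponents.

(** * A sufficient criterion for capability *)

Section CapableOfPresentation.
Import GRing.Theory.
Local Open Scope group_scope.
Variables (gT : finGroupType) (G : {group gT}) (a b : gT) (rs : relations).
Hypotheses (pG : presents rs G) (defG : <[a]> <*> <[b]> = G) (sab : satisfies rs a b).
Variables (n t p s N eta w : nat).
Hypothesis n_gt1 : (1 < n)%N.
Hypotheses (tn : (t %| n)%N) (pn : (p %| n)%N) (sn : (s %| n)%N) (Nn : (N %| n)%N).
Hypotheses (pt : (p %| 2 * t)%N) (st : (s %| 2 * t)%N).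
Hypotheses (Neta : (N %| 2 * t * eta)%N) (Nw : (N %| 2 * t * w)%N).
Hypotheses (an : a ^+ n = 1) (bn : b ^+ n = 1) (cn : [~ a, b] ^+ n = 1).
Hypothesis rels_central :
  forall r, r \in rs -> central_cond t p s N eta w r.1.1 r.1.2 (- (r.2 : int))%R.
Hypothesis central_trivial : forall i j k : nat,
  central_cond t p s N eta w i j k -> a ^+ i * b ^+ j * [~ a, b] ^+ k = 1.

(** The exponents of [d] and [e] are dropped because [[~ a, b]] is central in [G]. *)
Definition malcev_eval (u : malcev n) : gT :=
  let: (i, j, k, _, _) := u in a ^+ i * b ^+ j * [~ a, b] ^+ k.

Lemma malcev_evalM : {morph malcev_eval : u v / u * v}.
Proof.
have [ca cb] := satisfies_commute sab.
have ba (i j : nat) : b ^+ j * a ^+ i = a ^+ i * b ^+ j * [~ a, b] ^- (i * j).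
  have Vca : commute a [~ b, a] by rewrite -invgR; apply/commuteV/commute_sym.
  have Vcb : commute b [~ b, a] by rewrite -invgR; apply/commuteV/commute_sym.
  by rewrite commgC commXXg // -[[~ b, a]]invgR expVgn mulnC.
have cX (i j k : nat) :
  [~ a, b] ^+ k * (a ^+ i * b ^+ j) = a ^+ i * b ^+ j * [~ a, b] ^+ k.
  by apply: commuteM; apply: commuteX2.
move=> [[[[i j] k] l] m] [[[[i' j'] k'] l'] m'].
rewrite malcev_mulE /malcev_eval /malcev_mul.
rewrite !expg_ZnD // expg_ZnN // expg_ZnM //.
set z := (i' * j)%N.
have cVb (j1 : nat) : [~ a, b] ^- z * b ^+ j1 = b ^+ j1 * [~ a, b] ^- z.
  by apply/commute_sym/commuteV/commuteX2/commute_sym.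
have ccV : [~ a, b] ^- z * ([~ a, b] ^+ k * [~ a, b] ^+ k')
    = [~ a, b] ^+ k * [~ a, b] ^+ k' * [~ a, b] ^- z.
  by rewrite -expgnDr; apply/commute_sym/commuteV/commuteX2.
transitivity (a ^+ i * (b ^+ j * a ^+ i') * b ^+ j' * ([~ a, b] ^+ k * [~ a, b] ^+ k')).
  rewrite ba -/z -ccV !mulgA.
  by rewrite -[in RHS](mulgA _ ([~ a, b] ^- z) (b ^+ j')) cVb !mulgA.
rewrite -!mulgA; congr (_ * (_ * _)).
by rewrite (mulgA _ (b ^+ j') ([~ a, b] ^+ k')) (mulgA ([~ a, b] ^+ k) (_ * _)) cX !mulgA.
Qed.

Lemma malcev_eval_onto g : g \in G -> exists u, malcev_eval u = g.
Proof.
have evalM : {in [set: malcev n] &, {morph malcev_eval : u v / u * v}}.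
  exact: in2W malcev_evalM.
pose f := Morphism evalM.
suff sG : G \subset f @* setT by move/(subsetP sG)/morphimP=> [u _ _ ->]; exists u.
rewrite -defG join_subG !cycle_subG; apply/andP; split.
  apply/morphimP; exists (malcev_x n); rewrite ?in_setT // /= /malcev_eval /malcev_x.
  by rewrite [a ^+ _](expg_Zn_nat n_gt1 an 1) !expg0 !mulg1.
apply/morphimP; exists (malcev_y n); rewrite ?in_setT // /= /malcev_eval /malcev_y.
by rewrite [b ^+ _](expg_Zn_nat n_gt1 bn 1) !expg0 mulg1 mul1g.
Qed.

Let Q := tail_group eta w n_gt1 tn pn sn Nn.
Let nQ : Q <| [set: malcev n] := tail_group_normal n_gt1 tn pn sn Nn pt st Neta Nw.
Let mem_center := mem_rel_center n_gt1 tn pn sn Nn pt st Neta Nw.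

Let malcev_word (i j : nat) (k : 'Z_n) :
  malcev_x n ^+ i * malcev_y n ^+ j * [~ malcev_x n, malcev_y n] ^- k
  = (i%:~R, j%:~R, - k, 0, 0)%R.
Proof.
rewrite malcev_expx malcev_expy malcev_expc natr_Zp malcev_invE !malcev_mulE /=.
by do !congr (_, _); ring.
Qed.

(** A word vanishing in [G] is a relation of [G]. The defining relations hold modulo [rel_center Q]
    by [rels_central], hence so does this one. The converse is [central_trivial]. *)
Lemma malcev_eval_ker u : malcev_eval u = 1 <-> u \in rel_center Q.
Proof.
case: u => [[[[i j] k] l] m]; rewrite /malcev_eval.
have -> : ((i, j, k, l, m) : malcev n)
    = ((i : nat)%:~R, (j : nat)%:~R, (k : nat)%:~R, l, m)%R.
  by do !congr (_, _); apply: Zn_int.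
rewrite mem_center; split=> [F1|]; last exact: central_trivial.
have rel_ijk : a ^+ i * b ^+ j = [~ a, b] ^+ (- k)%R.
  by rewrite expg_ZnN //; apply: (mulIg ([~ a, b] ^+ k)); rewrite F1 mulVg.
have := presents_transfer_mod pG defG sab (rel_center_normal nQ) _ _ _ rel_ijk.
move/(_ (malcev_x n) (malcev_y n)).
rewrite malcev_word opprK [X in (_, _, X, _, _)%R]Zn_int mem_center.
have tailC l1 m1 : ((0, 0, 0, l1, m1)%R : malcev n) \in rel_center Q.
  apply/(rel_centerP nQ)=> v.
  by have /commute_sym/commgP/eqP-> := malcev_tail_central l1 m1 v; apply: group1.
apply=> [||r rr].
- by rewrite malcev_commxy malcev_comm_x oppr0.
- by rewrite malcev_commxy malcev_comm_y.
have -> : [~ malcev_x n, malcev_y n] ^+ r.2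
    = [~ malcev_x n, malcev_y n] ^+ (r.2%:R : 'Z_n)%R.
  by rewrite !malcev_expc natr_Zp.
rewrite malcev_word.
have -> : (- (r.2%:R : 'Z_n) = (- (r.2 : int))%:~R :> 'Z_n)%R by ring.
by rewrite mem_center rels_central.
Qed.

Lemma capable_of_presentation : capable G.
Proof.
apply: (capable_of_quotient nQ malcev_evalM _ malcev_eval_onto malcev_eval_ker).
move=> [[[[i j] k] l] m]; have Ga : a \in G by rewrite -defG mem_gen // inE cycle_id.
have Gb : b \in G by rewrite -defG mem_gen // inE cycle_id orbT.
by rewrite !groupM ?groupX ?groupR.
Qed.

End CapableOfPresentation.

Section CentralConditions.
Import GRing.Theory.
Local Open Scope ring_scope.
Variables (t p s N eta w : nat).

(** Each relation of types (i) and (ii) involves only [a] and [[a, b]], or only [b]; this form and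
    [central_cond_y] cover both kinds. *)
Lemma central_cond_xc (i k : int) :
  central_cond t p s N eta w i 0 k =
    [&& (p %| 2 * k)%Z, (N %| eta%:Z * (2 * k))%Z, (t %| i)%Z, (p %| i * (i - 1))%Z,
        (s %| 2 * k)%Z & (N %| i + eta%:Z * (i * (i - 1)) + w%:Z * (2 * k))%Z].
Proof.
by rewrite /central_cond mulr0 !mul0r mulr0 oppr0 add0r subr0 addr0 !dvdz0.
Qed.

Lemma central_cond_y (j : int) :
  central_cond t p s N eta w 0 j 0 =
    [&& (t %| j)%Z, (s %| j * (j - 1))%Z & (N %| - j - w%:Z * (j * (j - 1)))%Z].
Proof.
by rewrite /central_cond !mulr0 !mul0r !addr0 mulr0 !dvdz0 !andbT /=.
Qed.

End CentralConditions.

(** * The relation lists of the three types *)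

Section TypePresentations.
Local Open Scope group_scope.
Variables (gT : finGroupType) (G : {group gT}) (al be ga si : nat).

Definition rels_i : relations := [:: (2 ^ al, 0, 0); (0, 2 ^ be, 0); (0, 0, 2 ^ ga)]%N.

Definition rels_ii : relations :=
  [:: (2 ^ al, 0, 0); (0, 2 ^ be, 0); (2 ^ (al + si - ga), 0, 2 ^ si)]%N.

Definition rels_iii : relations :=
  [:: (2 ^ ga.+1, 0, 0); (0, 2 ^ ga.+1, 0); (0, 0, 2 ^ ga);
      (2 ^ ga, 0, 2 ^ ga.-1); (0, 2 ^ ga, 2 ^ ga.-1)]%N.

Lemma type_i_presents : type_i G al be ga -> presents rels_i G.
Proof.
case=> _ _ _ isoG rT H; rewrite isoG /satisfies /=; split.
  case/existsP=> -[x y] /=; rewrite !xpair_eqE /=.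
  case/and5P=> /eqP defH /eqP e1 /eqP e2 /eqP e3 /andP[/eqP e4 /eqP e5].
  by exists x, y; rewrite e1 e2 !mulg1 ?e5 ?e4 ?e3 ?e5 !eqxx.
case=> x [y [defH]]; rewrite !mulg1 !mul1g => /and5P[/eqP c1 /eqP c2 /eqP xn /eqP yn].
rewrite andbT => /eqP cn; apply/existsP; exists (x, y).
by rewrite /= !xpair_eqE /= defH c1 c2 xn yn -cn !eqxx.
Qed.

Lemma type_ii_presents : type_ii G al be ga si -> presents rels_ii G.
Proof.
case=> _ _ _ _ isoG rT H; rewrite isoG /satisfies /=; split.
  case/existsP=> -[x y] /=; rewrite !xpair_eqE /=.
  case/and5P=> /eqP defH /eqP e1 /eqP e2 /eqP e3 /andP[/eqP e4 /eqP e5].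
  by exists x, y; rewrite e1 e2 !mulg1 ?e5 ?e4 ?e3 ?e5 !eqxx.
case=> x [y [defH]]; rewrite !mulg1 !mul1g => /and5P[/eqP c1 /eqP c2 /eqP xn /eqP yn].
rewrite andbT => /eqP cn; apply/existsP; exists (x, y).
by rewrite /= !xpair_eqE /= defH c1 c2 xn yn cn !eqxx.
Qed.

Lemma type_iii_presents : type_iii G ga -> presents rels_iii G.
Proof.
case=> _ isoG rT H; rewrite isoG /satisfies /=; split.
  case/existsP=> -[x y] /=; rewrite !xpair_eqE /=.
  case/and5P=> /eqP defH /eqP e1 /eqP e2 /eqP e3 /and4P[/eqP e4 /eqP e5 /eqP e6 /eqP e7].
  by exists x, y; rewrite e1 e2 e3 e4 e5 e6 e7 !mulg1 !mul1g !eqxx.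
case=> x [y [defH]]; rewrite !mulg1 !mul1g => /and5P[/eqP c1 /eqP c2 /eqP xn /eqP yn].
case/and4P=> /eqP cn /eqP xe /eqP ye _; apply/existsP; exists (x, y).
by rewrite /= !xpair_eqE /= defH c1 c2 xn yn xe ye -cn !eqxx.
Qed.

End TypePresentations.

(** * Orders of the generators and of their commutator *)

Section OrderOfGenerators.
Import GRing.Theory.
Local Open Scope group_scope.
Variables (gT : finGroupType) (G : {group gT}) (a b : gT) (al be ga si : nat).
Hypothesis defG : <[a]> <*> <[b]> = G.

Lemma type_i_order_a m :
    type_i G al be ga -> satisfies (rels_i al be ga) a b -> a ^+ m = 1 ->
  2 ^ al %| m.
Proof.
move=> tG sab am; have pG := type_i_presents tG; case: tG => ga_gt0 ga_be be_al _.
have n_gt1 : 1 < 2 ^ al by rewrite -(expn0 2) ltn_exp2l //; lia.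
(* Only [T] is nontrivial: the quotient is cyclic of order [2 ^ al], generated by the image of
   [x]. *)
have : class2_cond (2 ^ al) 1 1 1 0 0 m 0 0.
  apply: (class2_bound n_gt1 _ _ _ _ _ _ _ _ pG defG sab);
    rewrite ?dvd1n ?expg0 ?mulg1 //.
  move=> r; rewrite !inE => /or3P[] /eqP->;
  by rewrite /class2_cond /= !dvdzE /= ?dvd1n ?dvdn0 ?dvdnn.
by case/and4P; rewrite dvdzE.
Qed.

Lemma type_ii_order_b m :
    type_ii G al be ga si -> satisfies (rels_ii al be ga si) a b -> b ^+ m = 1 ->
  2 ^ be %| m.
Proof.
move=> tG sab bm; have pG := type_ii_presents tG; case: tG => ga_be si_ga _ _ _.
have n_gt1 : 1 < 2 ^ be by rewrite -(expn0 2) ltn_exp2l //; lia.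
have : class2_cond 1 (2 ^ be) 1 1 0 0 0 m 0.
  apply: (class2_bound n_gt1 _ _ _ _ _ _ _ _ pG defG sab);
    rewrite ?dvd1n ?expg0 ?mul1g //.
  move=> r; rewrite !inE => /or3P[] /eqP->;
  by rewrite /class2_cond /= !dvdzE /= ?dvd1n ?dvdn0 ?dvdnn.
by case/and4P=> _; rewrite dvdzE.
Qed.

Lemma type_ii_order_comm m :
    type_ii G al be ga si -> satisfies (rels_ii al be ga si) a b ->
  [~ a, b] ^+ m = 1 -> 2 ^ ga %| m.
Proof.
move=> tG sab cm; have pG := type_ii_presents tG; case: tG => ga_be si_ga al_si _ _.
have n_gt1 : 1 < 2 ^ (al + be) by rewrite -(expn0 2) ltn_exp2l //; lia.
(* The weight [2 ^ (al - ga)] lets [c] count as that power of [x], in accordance with the last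
   relation. For [c^m] the congruence reads [2 ^ al %| 2 ^ (al - ga) * m]. *)
have : class2_cond (2 ^ (al + si - ga)) (2 ^ be) (2 ^ si) (2 ^ al)
    0 (2 ^ (al - ga)) 0 0 m.
  apply: (class2_bound n_gt1 _ _ _ _ _ _ _ _ pG defG sab);
    rewrite -?expnD ?dvdn_exp2l ?expg0 ?mul1g //; try lia.
  move=> r; rewrite !inE => /or3P[] /eqP->; rewrite /class2_cond /=
    ?mulr0 ?subr0 ?addr0 ?dvdz0 ?mul0r ?dvdz0 /=.
  - by rewrite !dvdzE !dvdn_exp2l //; lia.
  - by rewrite dvdzz.
  rewrite !dvdzz /= -PoszM -expnD.
  by rewrite (_ : al - ga + si = al + si - ga)%N ?subrr ?dvdz0 //; lia.
case/and4P=> _ _ _; rewrite mul0r !add0r rpredN -PoszM dvdzE /=.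
rewrite -[in X in X %| _ -> _](@subnK ga al); last lia.
by rewrite expnD dvdn_pmul2l // expn_gt0.
Qed.

Lemma type_iii_order_comm m :
    type_iii G ga -> satisfies (rels_iii ga) a b -> [~ a, b] ^+ m = 1 ->
  2 ^ ga %| m.
Proof.
move=> tG sab cm; have pG := type_iii_presents tG; case: tG => ga_gt0 _.
have n_gt1 : 1 < 2 ^ ga.+1 by rewrite -(expn0 2) ltn_exp2l //; lia.
have E2 : (2 * 2 ^ ga.-1 = 2 ^ ga)%N by rewrite -expnS prednK.
(* With weights [1, 1, 2] for [x], [y], [c], both sides of the last two relations weigh [2 ^ ga]. *)
have : class2_cond (2 ^ ga) (2 ^ ga) (2 ^ ga.-1) (2 ^ ga.+1) 1 2 0 0 m.
  apply: (class2_bound n_gt1 _ _ _ _ _ _ _ _ pG defG sab);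
    rewrite -?expnS ?dvdn_exp2l ?expg0 ?mul1g //; try lia.
  move=> r; rewrite !inE => /or4P[||| /orP[]] /eqP->; rewrite /class2_cond /=
    ?mulr0 ?subr0 ?addr0 ?dvdz0 ?mul1r ?add0r ?sub0r -?PoszM ?E2 ?subrr
    ?dvdz0 ?dvdzz /= ?rpredN ?dvdzE /= -?expnS ?dvdn_exp2l //; lia.
case/and4P=> _ _ _; rewrite mulr0 !add0r rpredN -PoszM dvdzE /=.
by rewrite expnS dvdn_pmul2l.
Qed.

End OrderOfGenerators.

(** * Necessity of the listed parameters *)

Section NonCapable.
Local Open Scope group_scope.

Lemma expg_dvdn (K : groupType) (g : K) m n : g ^+ m = 1 -> m %| n -> g ^+ n = 1.
Proof. by move=> gm /dvdnP[q ->]; rewrite mulnC expgnA gm expg1n. Qed.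

(** The cofactor is odd, so one factor two is lost against [2 ^ m.+1]; this loss separates the cases
    [ga < be] and [be = ga]. *)
Lemma bin2_exp2 m : ('C(2 ^ m.+1, 2) = 2 ^ m * (2 ^ m.+1).-1)%N.
Proof. by rewrite bin2 {1}expnS -mulnA mul2n doubleK. Qed.

Lemma dvdn_bin2_exp2 k m : k < m -> (2 ^ k %| 'C(2 ^ m, 2))%N.
Proof. by case: m => // m km; rewrite bin2_exp2 dvdn_mulr // dvdn_exp2l. Qed.

Lemma exp2_dvd_double_bin2 m : (2 ^ m %| 'C(2 ^ m, 2) * 2)%N.
Proof.
case: m => [|m]; first exact: dvd1n.
by rewrite bin2_exp2 mulnAC -expnSr dvdn_mulr.
Qed.

Variables (gT : finGroupType) (G : {group gT}) (al be ga si : nat).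

(** With [M = 2 ^ be], the relation [b^M = 1] gives [c^M e^C(M,2) = 1]. If [ga < be] the second
    factor vanishes, so [x^M] is central and [al <= be]. If [be = ga], squaring still gives
    [c^(2M) = 1], so [al <= be.+1]. *)
Lemma type_i_capable_only :
  type_i G al be ga -> capable G -> al = be \/ al = be.+1 /\ be = ga.
Proof.
move=> tG capG; have [a [b [defG sab]]] := presents_gen (type_i_presents tG).
have order_a m := @type_i_order_a _ G a b al be ga defG m tG sab.
have [ca cb] := satisfies_commute sab.
have [K [c [d [e [[dc ec] _ relb [relc xa _ _]]]]]] := capable_class3 capG defG ca cb.
case: tG => ga_gt0 ga_be be_al _.
have bM : b ^+ (2 ^ be) = [~ a, b] ^+ 0.
  have := satisfies_rel (i := 0) (j := (2 ^ be)%N) (k := 0) sab.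
  by rewrite mul1g; apply; rewrite !inE eqxx orbT.
have cL : [~ a, b] ^+ (2 ^ ga) = 1.
  have := satisfies_rel (i := 0) (j := 0) (k := (2 ^ ga)%N) sab.
  by rewrite mul1g => <- //; rewrite !inE eqxx !orbT.
have [_] := relb _ _ bM; rewrite mulg1 => cM.
have [dL eL] := relc _ cL.
have al_le k : a ^+ (2 ^ k) = 1 -> al <= k.
  by move/order_a; rewrite dvdn_Pexp2l.
have [gb | eq_gb] : ga < be \/ be = ga by lia.
  left; apply/eqP; rewrite eqn_leq be_al andbT; apply/al_le/xa.
  rewrite (expg_dvdn dL) ?dvdn_bin2_exp2 // mulg1.
  by move: cM; rewrite (expg_dvdn eL) ?dvdn_bin2_exp2 // mulg1.
suff: al <= be.+1 by lia.
have d1 : d ^+ 'C(2 ^ be.+1, 2) = 1.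
  by apply: (expg_dvdn dL); apply: dvdn_bin2_exp2; lia.
apply/al_le/xa; rewrite d1 mulg1.
have: (c ^+ (2 ^ be) * e ^+ 'C(2 ^ be, 2)) ^+ 2 = 1 by rewrite cM expg1n.
rewrite expgMn; last exact/commuteX2/commute_sym.
rewrite -!expgnA -expnSr (@expg_dvdn _ e (2 ^ ga)%N) ?mulg1 // -eq_gb.
exact: exp2_dvd_double_bin2.
Qed.

(** Since [[a, b]^(2^(ga-1))] is a power of [a] and a power of [b], its lift commutes with [x] and
    [y]. It would thus be trivial, against the order of [[a, b]]. *)
Lemma type_iii_not_capable : type_iii G ga -> ~ capable G.
Proof.
move=> tG capG; have [a [b [defG sab]]] := presents_gen (type_iii_presents tG).
have [ca cb] := satisfies_commute sab.
have [K [c [d [e [_ rela relb [_ _ _ ca1]]]]]] := capable_class3 capG defG ca cb.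
have aL : a ^+ (2 ^ ga) = [~ a, b] ^+ (2 ^ ga.-1).
  have := satisfies_rel (i := (2 ^ ga)%N) (j := 0) (k := (2 ^ ga.-1)%N) sab.
  by rewrite mulg1; apply; rewrite !inE eqxx !orbT.
have bL : b ^+ (2 ^ ga) = [~ a, b] ^+ (2 ^ ga.-1).
  have := satisfies_rel (i := 0) (j := (2 ^ ga)%N) (k := (2 ^ ga.-1)%N) sab.
  by rewrite mul1g; apply; rewrite !inE eqxx !orbT.
have [[d1 _] [e1 _]] := (rela _ _ aL, relb _ _ bL).
have := type_iii_order_comm defG tG sab (ca1 _ d1 e1).
by case: tG => ga_gt0 _; rewrite dvdn_Pexp2l //; lia.
Qed.

(** The relation between [a] and [[a, b]] becomes [c^(2^T) = e^(2^si)] with [T = al + si - ga].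
    Outside the listed cases, this and [c^M e^C(M,2) = 1] for [M = 2 ^ be] force [e^(2^(ga-1))] or
    [b^(2^(be-1))] to be trivial. *)
Lemma type_ii_capable_only :
    type_ii G al be ga si -> capable G ->
  al = be /\ ga < be.-1 \/ [/\ al = be.+1, be = ga & ga = si.+1].
Proof.
move=> tG capG; have [a [b [defG sab]]] := presents_gen (type_ii_presents tG).
have order_b m := @type_ii_order_b _ G a b al be ga si defG m tG sab.
have order_c m := @type_ii_order_comm _ G a b al be ga si defG m tG sab.
have [ca cb] := satisfies_commute sab.
have [K [c [d [e [[dc ec] rela relb [relc _ yb cc]]]]]] := capable_class3 capG defG ca cb.
case: tG => ga_be si_ga al_si _ _.
set T := al + si - ga in sab.
have aN : a ^+ (2 ^ al) = 1.
  have := satisfies_rel (i := (2 ^ al)%N) (j := 0) (k := 0) sab.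
  by rewrite mulg1; apply; rewrite !inE eqxx.
have bM : b ^+ (2 ^ be) = [~ a, b] ^+ 0.
  have := satisfies_rel (i := 0) (j := (2 ^ be)%N) (k := 0) sab.
  by rewrite mul1g; apply; rewrite !inE eqxx orbT.
have aT : a ^+ (2 ^ T) = [~ a, b] ^+ (2 ^ si).
  have := satisfies_rel (i := (2 ^ T)%N) (j := 0) (k := (2 ^ si)%N) sab.
  by rewrite mulg1 => -> //; rewrite !inE eqxx !orbT.
have cL : [~ a, b] ^+ (2 ^ ga) = 1.
  rewrite -(subnKC (ltnW si_ga)) expnD expgnA -aT -expgnA -expnD.
  by rewrite (_ : T + (ga - si) = al) // /T; lia.
have [_] := relb _ _ bM; rewrite mulg1 => cM.
have [dL eL] := relc _ cL.
have [dS cT] := rela _ _ aT.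
have {}cT : c ^+ (2 ^ T) = e ^+ (2 ^ si).
  rewrite -cT (@expg_dvdn _ d (2 ^ si)%N) ?mulg1 //.
  by apply: dvdn_bin2_exp2; rewrite /T; lia.
have eL2 : e ^+ (2 ^ ga.-1) <> 1.
  move=> e1; have /order_c : [~ a, b] ^+ (2 ^ ga.-1) = 1.
    by apply: cc => //; apply: expg_dvdn dS _; rewrite dvdn_exp2l //; lia.
  by rewrite dvdn_Pexp2l //; lia.
have bM2 : b ^+ (2 ^ be.-1) <> 1 by move/order_b; rewrite dvdn_Pexp2l //; lia.
have cTS k : c ^+ (2 ^ (T + k)) = e ^+ (2 ^ (si + k)).
  by rewrite !expnD expgnA cT -expgnA.
have [gb | eq_gb] : ga < be \/ be = ga by lia.
  have {}cM : c ^+ (2 ^ be) = 1.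
    by move: cM; rewrite (expg_dvdn eL) ?dvdn_bin2_exp2 // mulg1.
  have [ba | [ab | eq_ab]] : be < al \/ al < be \/ al = be by lia.
  (* Here [e^(2^(ga-1)) = c^(2^(al-1))], and [al - 1 >= be]. *)
  - case: eL2; rewrite (_ : ga.-1 = si + (ga.-1 - si)); last lia.
    by rewrite -cTS (expg_dvdn cM) // dvdn_exp2l // /T; lia.
  - case: bM2; apply: yb.
    have cN : c ^+ (2 ^ al) = 1.
      by rewrite (_ : al = T + (ga - si)) ?cTS ?subnKC ?(ltnW si_ga) // /T; lia.
    rewrite (expg_dvdn cN) ?dvdn_exp2l ?mul1g; try lia.
    by apply: (expg_dvdn eL); apply: dvdn_bin2_exp2; lia.
  have [|ga_be1] : ga < be.-1 \/ ga = be.-1 by lia.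
    by left.
  case: bM2; apply: yb.
  have [Tb sb] : T = be.-1 /\ ga = si.+1 by rewrite /T; lia.
  (* The exponents of [e] add up to [2^si + 2^si (2^ga - 1) = 2^si 2^ga]. *)
  rewrite -Tb cT Tb -ga_be1 sb bin2_exp2 -expgnDr -mulnS prednK ?expn_gt0 //.
  by apply: (expg_dvdn eL); rewrite sb dvdn_mull.
have c2L : c ^+ (2 ^ be.+1) = 1.
  have: (c ^+ (2 ^ be) * e ^+ 'C(2 ^ be, 2)) ^+ 2 = 1 by rewrite cM expg1n.
  rewrite expgMn; last exact/commuteX2/commute_sym.
  rewrite -!expgnA -expnSr (@expg_dvdn _ e (2 ^ ga)%N) ?mulg1 // -eq_gb.
  exact: exp2_dvd_double_bin2.
have [lt_gT | eq_gT] : ga < T \/ T = ga by rewrite /T; lia.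
  case: eL2; rewrite (_ : ga.-1 = si + (ga.-1 - si)); last lia.
  by rewrite -cTS (expg_dvdn c2L) // dvdn_exp2l //; lia.
have [eq_gs | lt_sg] : ga = si.+1 \/ si < ga.-1 by lia.
  by right; split=> //; move: eq_gT; rewrite /T; lia.
case: eL2.
(* As [T = be], the first factor is [e^(2^si)]. The power turns it into [e^(2^(ga-1))] and kills the
   second factor, because [ga.-1 - si > 0]. *)
have: (c ^+ (2 ^ be) * e ^+ 'C(2 ^ be, 2)) ^+ (2 ^ (ga.-1 - si)) = 1 by rewrite cM expg1n.
rewrite eq_gb -{1}eq_gT cT -expgnDr -expgnA mulnDl -expnD subnKC; last lia.
rewrite expgnDr [X in _ * X](expg_dvdn eL) ?mulg1 //.
have -> : ga = ga.-1.+1 by lia.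
rewrite bin2_exp2 /= mulnAC -expnD dvdn_mulr // dvdn_exp2l //; lia.
Qed.

End NonCapable.

(** * Sufficiency: a quotient for each listed case *)

Section Capable.
Import GRing.Theory.
Local Open Scope group_scope.
Variables (gT : finGroupType) (G : {group gT}) (al be ga si : nat).

Lemma expg_dvdz (g : gT) m (n : nat) : g ^+ m = 1 -> (m %| (n : int))%Z -> g ^+ n = 1.
Proof. by move=> gm; rewrite dvdzE; apply: expg_dvdn. Qed.

(** For [w = 1] the last congruence on [y^j] concerns [j * j], which gains a factor two over [j] by
    [dvdz_exp2_sqr]. *)
Let subr_mulBr1 (j : int) : (- j - 1 * (j * (j - 1)) = - (j * j))%R.
Proof. by ring. Qed.

Lemma dvdz_exp2 m n : m <= n -> ((2 ^ m)%N %| ((2 ^ n)%N : int))%Z.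
Proof. by move=> le_mn; rewrite dvdzE dvdn_exp2l. Qed.

Lemma dvdz_exp2_sqr m (z : int) :
  0 < m -> ((2 ^ m)%N %| z)%Z -> ((2 ^ m.+1)%N %| (z * z)%R)%Z.
Proof.
move=> m_gt0 /dvdzP[q ->]; rewrite mulrACA.
by rewrite dvdz_mull // -PoszM -expnD dvdz_exp2 //; lia.
Qed.

Lemma type_i_rels (a b : gT) : satisfies (rels_i al be ga) a b ->
  [/\ a ^+ (2 ^ al) = 1, b ^+ (2 ^ be) = 1 & [~ a, b] ^+ (2 ^ ga) = 1].
Proof.
move=> sab; split.
- have := satisfies_rel (i := (2 ^ al)%N) (j := 0) (k := 0) sab.
  by rewrite mulg1; apply; rewrite !inE eqxx.
- have := satisfies_rel (i := 0) (j := (2 ^ be)%N) (k := 0) sab.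
  by rewrite mul1g; apply; rewrite !inE eqxx orbT.
have := satisfies_rel (i := 0) (j := 0) (k := (2 ^ ga)%N) sab.
by rewrite mul1g => <- //; rewrite !inE eqxx !orbT.
Qed.

Lemma type_i_capable_lt : type_i G al be ga -> al = be -> ga < be -> capable G.
Proof.
move=> tG eq_ab lt_gb; have pG := type_i_presents tG.
have [a [b [defG sab]]] := presents_gen pG.
have [aN bM cL] := type_i_rels sab; rewrite eq_ab in aN.
have n_gt1 : 1 < 2 ^ be by rewrite -(expn0 2) ltn_exp2l //; lia.
have cM : [~ a, b] ^+ (2 ^ be) = 1 by apply: expg_dvdn cL _; rewrite dvdn_exp2l // ltnW.
(* [c^M = e^L = 1] with [M = 2^be], [L = 2^ga]; [d] is killed. *)
apply: (@capable_of_presentation _ G a b (rels_i al be ga) pG defG sab (2 ^ be)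
  (2 ^ be) 1 (2 ^ ga.+1) 1 0 0); rewrite ?dvd1n ?dvdnn // ?dvdn_exp2l //.
- by rewrite dvdn_mull // dvdn_exp2l.
- move=> r; rewrite !inE => /or3P[] /eqP->;
    rewrite /= ?oppr0 ?central_cond_y ?central_cond_xc.
  + by rewrite !dvd1z mulr0 !dvdz0 eq_ab dvdzz.
  + by rewrite !dvd1z dvdzz /= dvdz_mulr // dvdz_exp2.
  by rewrite !dvd1z !dvdz0 expnS PoszM mulrN !rpredN dvdzz.
move=> i j k /and5P[Mj _ _ _ /and4P[Mi _ Lk _]].
rewrite (expg_dvdz aN Mi) (expg_dvdz bM Mj) !mul1g; apply: expg_dvdz cL _.
(* The congruence on [e] says that [2 ^ ga] divides [k + i * j], so only the mixed term has to be
   removed. *)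
have Lj : ((2 ^ ga)%N %| (i%:Z * j%:Z)%R)%Z.
  by rewrite dvdz_mull // (dvdz_trans _ Mj) // dvdz_exp2 // ltnW.
by move: Lk; rewrite expnS PoszM -mulrA -mulrDr dvdz_mul2l // rpredDr.
Qed.

Lemma type_i_capable_eq : type_i G al be ga -> al = be -> be = ga -> capable G.
Proof.
move=> tG eq_ab eq_bg; have pG := type_i_presents tG.
have [a [b [defG sab]]] := presents_gen pG.
have [aN bM cL] := type_i_rels sab; rewrite eq_ab in aN; rewrite -eq_bg in cL.
have be_gt0 : 0 < be by case: tG; lia.
have n_gt1 : 1 < 2 ^ be.+1 by rewrite -(expn0 2) ltn_exp2l.
have dn : (2 ^ be %| 2 ^ be.+1)%N by rewrite dvdn_exp2l.
(* [d = e] and [c^M = e^(M/2)] with [M = 2^be]. *)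
apply: (@capable_of_presentation _ G a b (rels_i al be ga) pG defG sab (2 ^ be.+1)
  (2 ^ be) 1 1 (2 ^ be.+1) 1 1); rewrite ?dvd1n ?dvdnn -?expnS ?muln1 //;
  try by [apply: expg_dvdn dn].
- move=> r; rewrite !inE => /or3P[] /eqP->;
    rewrite /= ?oppr0 ?central_cond_y ?central_cond_xc.
  + rewrite !dvd1z !mulr0 !dvdz0 eq_ab dvdzz !mul1r addr0 /=.
    rewrite mulrBr mulr1 addrCA subrr addr0.
    by rewrite dvdz_exp2_sqr.
  + rewrite !dvd1z dvdzz subr_mulBr1 rpredN /=.
    by rewrite dvdz_exp2_sqr.
  by rewrite !dvd1z !dvdz0 -eq_bg mulr0 add0r !mul1r mulrN rpredN expnS PoszM dvdzz.
move=> i j k /and5P[Mj _ _ Nk /and4P[Mi _ _ _]].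
rewrite (expg_dvdz aN Mi) (expg_dvdz bM Mj) !mul1g; apply: expg_dvdz cL _.
have Njj := dvdz_exp2_sqr be_gt0 Mj.
have: ((2 ^ be.+1)%N %| (2 * k%:Z)%R)%Z.
  have -> : (2 * k%:Z = - j%:Z + 1 * (2 * k%:Z) - 1 * (j%:Z * (j%:Z - 1))
    + j%:Z * j%:Z)%R by ring.
  by rewrite rpredD.
by rewrite expnS PoszM dvdz_mul2l.
Qed.

Lemma type_i_capable_succ : type_i G al be ga -> al = be.+1 -> be = ga -> capable G.
Proof.
move=> tG eq_ab eq_bg; have pG := type_i_presents tG.
have [a [b [defG sab]]] := presents_gen pG.
have [aN bM cL] := type_i_rels sab; rewrite eq_ab in aN; rewrite -eq_bg in cL.
have be_gt0 : 0 < be by case: tG; lia.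
have n_gt1 : 1 < 2 ^ be.+1 by rewrite -(expn0 2) ltn_exp2l.
have dn : (2 ^ be %| 2 ^ be.+1)%N by rewrite dvdn_exp2l.
(* [c^M = e^(M/2)] and [d^M = e^M = 1] with [M = 2^be]. *)
apply: (@capable_of_presentation _ G a b (rels_i al be ga) pG defG sab (2 ^ be.+1)
  (2 ^ be) (2 ^ be.+1) 1 (2 ^ be.+1) 0 1); rewrite ?dvd1n ?dvdnn -?expnS ?muln1 ?muln0 //;
  try by [apply: expg_dvdn dn].
- move=> r; rewrite !inE => /or3P[] /eqP->;
    rewrite /= ?oppr0 ?central_cond_y ?central_cond_xc.
  + rewrite !dvd1z !mulr0 !dvdz0 eq_ab !mul0r !addr0 dvdzz /=.
    by rewrite dvdz_mulr // dvdz_exp2.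
  + rewrite !dvd1z dvdzz subr_mulBr1 rpredN /=.
    by rewrite dvdz_exp2_sqr.
  by rewrite !dvd1z !mul0r !dvdz0 -eq_bg !add0r mul1r mulrN rpredN expnS PoszM dvdzz.
move=> i j k /and5P[Mj Nk _ _ /and4P[Mi Ni _ _]].
have Nii := dvdz_exp2_sqr be_gt0 Mi.
rewrite (expg_dvdz bM Mj) (@expg_dvdz a (2 ^ be.+1)%N) // ?mul1g.
  by apply: expg_dvdz cL _; move: Nk; rewrite expnS PoszM dvdz_mul2l.
(* The modulus [t] only gives [2 ^ be %| i]; the missing factor two comes from the congruence for
   [d] on [i * (i - 1)]. *)
have -> : (i%:Z = i%:Z * i%:Z - i%:Z * (i%:Z - 1))%R by ring.
by rewrite rpredB.
Qed.

Lemma type_ii_capable :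
    type_ii G al be ga si ->
    al = be /\ ga < be.-1 \/ [/\ al = be.+1, be = ga & ga = si.+1] ->
  capable G.
Proof.
move=> tG cases; have pG := type_ii_presents tG.
have [a [b [defG sab]]] := presents_gen pG.
case: tG => ga_be si_ga al_si _ _.
(* [w] solves [2^w * (2 * 2^si) = 2^T], which makes the last relation of [G] satisfy the congruence
   modulo [N] exactly. *)
pose T := al + si - ga; pose w := al - ga.+1.
have defT : al + si - ga = T by [].
have [aN bM aT] : [/\ a ^+ (2 ^ al) = 1, b ^+ (2 ^ be) = 1
    & a ^+ (2 ^ T) = [~ a, b] ^+ (2 ^ si)].
  split.
  - have := satisfies_rel (i := (2 ^ al)%N) (j := 0) (k := 0) sab.
    by rewrite mulg1; apply; rewrite !inE eqxx.
  - have := satisfies_rel (i := 0) (j := (2 ^ be)%N) (k := 0) sab.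
    by rewrite mul1g; apply; rewrite !inE eqxx orbT.
  have := satisfies_rel (i := (2 ^ T)%N) (j := 0) (k := (2 ^ si)%N) sab.
  by rewrite mulg1; apply; rewrite !inE eqxx !orbT.
have cL : [~ a, b] ^+ (2 ^ ga) = 1.
  rewrite -(subnKC (ltnW si_ga)) expnD expgnA -aT -expgnA -expnD.
  by rewrite (_ : T + (ga - si) = al) // /T; lia.
have n_gt1 : 1 < 2 ^ (al + be) by rewrite -(expn0 2) ltn_exp2l //; lia.
have w2S : (2 ^ w * (2 * 2 ^ si) = 2 ^ T)%N.
  by rewrite -expnS -expnD; congr (2 ^ _)%N; rewrite /w /T; lia.
have pow_le : [/\ si.+1 <= T, T <= al, T <= be & al <= w + T + T].
  by split; rewrite /T /w; case: cases => [[]|[]]; lia.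
case: pow_le => sT Tal Tbe alw.
have alwT : al <= w + T.+1 by rewrite /T /w; lia.
have w_gt0 : al = be -> ga < be.-1 -> 0 < w by rewrite /w; lia.
have beT : al = be.+1 -> be = ga -> ga = si.+1 -> be <= T by rewrite /T; lia.
have def_al : al = ga - si + T by rewrite /T; lia.
(* [c^(2^T) = e^(2^si)] and [e^(2^ga) = 1]; [d] is killed. *)
apply: (@capable_of_presentation _ G a b (rels_ii al be ga si) pG defG sab (2 ^ (al + be))
    (2 ^ T) 1 (2 ^ si.+1) (2 ^ al) 0 (2 ^ w));
  rewrite ?dvd1n ?muln0 ?dvdn0 // -?expnS -?expnD ?dvdn_exp2l //; try lia.
- by apply: expg_dvdn aN _; rewrite dvdn_exp2l ?leq_addr.
- by apply: expg_dvdn bM _; rewrite dvdn_exp2l ?leq_addl.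
- by apply: expg_dvdn cL _; rewrite dvdn_exp2l //; lia.
- move=> r; rewrite !inE => /or3P[] /eqP->; rewrite /= ?oppr0
    ?central_cond_y ?central_cond_xc ?dvd1z ?mulr0 ?mul0r ?dvdz0 ?addr0 /=.
  + by rewrite dvdzz dvdz_exp2.
  + rewrite dvdz_exp2 // dvdz_mulr ?dvdz_exp2 //=; last lia.
    case: cases => [[<- _] | [eq_ab eq_bg eq_gs]].
      by rewrite rpredB ?rpredN ?dvdzz // dvdz_mull // dvdz_mulr.
    have -> : w = 0 by rewrite /w; lia.
    rewrite subr_mulBr1 rpredN /=.
    by rewrite eq_ab dvdz_exp2_sqr //; lia.
  rewrite defT dvdzz expnS PoszM mulrN rpredN dvdzz /= mulrN -!PoszM w2S.
  by rewrite subrr dvdz0.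
move=> i j k /and5P[Tj _ _ Nj /and4P[Ti _ Sk Ni]].
have bj : b ^+ j = 1.
  case: cases => [[eq_ab lt_gb] | [eq_ab eq_bg eq_gs]]; last first.
    by apply: expg_dvdz bM _; apply: dvdz_trans Tj; apply/dvdz_exp2/beT.
  apply: expg_dvdz bM _; rewrite -eq_ab.
  (* Modulo [2 ^ al] the term in [j * j] vanishes and [j * (1 - 2^w) = 0] remains. The condition
     [ga < be.-1] gives [w > 0], so the second factor is odd. *)
  have odd_w : coprimez (2 ^ al)%N (1 - (2 ^ w)%N%:Z)%R.
    have {}w_gt0 := w_gt0 eq_ab lt_gb.
    have pow_gt0 : 0 < 2 ^ w.-1 by rewrite expn_gt0.
    rewrite -coprimezN opprB subzn ?expn_gt0 // coprimezE coprimeXl // coprime2n.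
    rewrite absz_nat subn1 -(prednK w_gt0) expnS mul2n.
    by case: (2 ^ w.-1)%N pow_gt0 => // m _; rewrite doubleS /= odd_double.
  rewrite -(Gauss_dvdzl _ odd_w).
  have -> : (j%:Z * (1 - (2 ^ w)%N%:Z) =
      - (- j%:Z + 0 * (2 * k%:Z) - (2 ^ w)%N%:Z * (j%:Z * (j%:Z - 1)))
      - (2 ^ w)%N%:Z * (j%:Z * j%:Z))%R by ring.
  rewrite rpredB ?rpredN //; case/dvdzP: Tj => q ->.
  rewrite (_ : _ * (_ * _) = q * q * ((2 ^ w)%N%:Z * ((2 ^ T)%N%:Z * (2 ^ T)%N%:Z)))%R;
    last by ring.
  by rewrite dvdz_mull // -!PoszM -!expnD dvdz_exp2 // addnA.
rewrite bj mulg1.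
have Nij : ((2 ^ al)%N %| ((2 ^ w)%N%:Z * (2 * i%:Z * j%:Z))%R)%Z.
  case/dvdzP: Ti => q ->.
  rewrite (_ : (2 ^ w)%N%:Z * _ = q * j%:Z * ((2 ^ w)%N%:Z * (2 * (2 ^ T)%N%:Z)))%R;
    last by ring.
  by rewrite dvdz_mull // -!PoszM -expnS -expnD dvdz_exp2.
have Si : ((2 ^ si)%N %| i%:Z)%Z by apply: dvdz_trans Ti; rewrite dvdz_exp2 // ltnW.
have {}Sk : ((2 ^ si)%N %| k%:Z)%Z.
  have Sij : ((2 ^ si)%N %| (i%:Z * j%:Z)%R)%Z by rewrite dvdz_mulr.
  by move: Sk; rewrite expnS PoszM -mulrA -mulrDr dvdz_mul2l // rpredDr.
have {}Ni : ((2 ^ al)%N %| (i%:Z + (2 ^ w)%N%:Z * (2 * k%:Z))%R)%Z.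
  by move: Ni; rewrite mul0r addr0 mulrDr addrA rpredDr.
rewrite dvdzE /= in Ti; rewrite dvdzE /= in Sk; rewrite -!PoszM -PoszD dvdzE /= in Ni.
case/dvdnP: Ti Ni => i1 ->; case/dvdnP: Sk => k1 ->.
(* With [i = i1 * 2^T] and [k = k1 * 2^si], the word equals [[a, b]^(2^si (i1 + k1))], and the
   congruence says [2^(ga-si) %| i1 + k1]. *)
rewrite (_ : _ + _ = (i1 + k1) * 2 ^ T)%N; last by rewrite -w2S; ring.
rewrite {1}def_al.
rewrite expnD dvdn_pmul2r ?expn_gt0 // => Nik.
rewrite ![(_ * 2 ^ _)%N]mulnC !expgnA aT -!expgnA -expgnDr -mulnDr.
apply: expg_dvdn cL _.
by rewrite -(subnKC (ltnW si_ga)) expnD dvdn_pmul2l ?expn_gt0 ?addKn.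
Qed.

End Capable.

Theorem theorem8p1 (gT : finGroupType) (G : {group gT}) :
  ((exists al be ga, type_i G al be ga) \/
   (exists al be ga si, type_ii G al be ga si) \/
   (exists ga, type_iii G ga)) ->
  (capable G <->
     (exists al be ga, type_i G al be ga /\ al = be) \/
     (exists al be ga, type_i G al be ga /\ al = be.+1 /\ be = ga) \/
     (exists al be ga si, type_ii G al be ga si /\ al = be /\ ga < be.-1) \/
     (exists al be ga si, type_ii G al be ga si /\
                           al = be.+1 /\ be = ga /\ ga = si.+1))
  /\ ((exists ga, type_iii G ga) -> ~ capable G).
Proof.
move=> typeG; split; last by case=> ga; apply: type_iii_not_capable.
split=> [capG | ].
  case: typeG => [[al [be [ga tG]]] | [[al [be [ga [si tG]]]] | [ga tG]]].
  - have [eq_ab | [eq_ab eq_bg]] := type_i_capable_only tG capG.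
      by left; exists al, be, ga.
    by right; left; exists al, be, ga.
  - have [[eq_ab lt_gb] | [eq_ab eq_bg eq_gs]] := type_ii_capable_only tG capG.
      by do 2 right; left; exists al, be, ga, si.
    by do 3 right; exists al, be, ga, si.
  by case: (type_iii_not_capable tG).
case=> [[al [be [ga [tG eq_ab]]]] | [[al [be [ga [tG [eq_ab eq_bg]]]]] | ]].
(* Case (a) needs two different quotients, according to whether [C(2^be, 2)] is divisible by
   [2 ^ ga]. *)
- have [_ le_gb _ _] := tG; move: le_gb; rewrite leq_eqVlt => /orP[/eqP eq_gb | lt_gb].
    exact: type_i_capable_eq tG eq_ab (esym eq_gb).
  exact: type_i_capable_lt tG eq_ab lt_gb.
- exact: type_i_capable_succ tG eq_ab eq_bg.
case=> [[al [be [ga [si [tG [eq_ab lt_gb]]]]]] | ].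
  by apply: type_ii_capable tG _; left.
case=> [al [be [ga [si [tG [eq_ab [eq_bg eq_gs]]]]]]].
by apply: type_ii_capable tG _; right.
Qed.
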